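(* Let $\lambda\in\mathbb R$ with $\lambda\le 2$ and $\lambda\ne 1$. Consider solutions $u\in C^\infty(\overline{\mathbb D})$ (real-valued) of the boundary value problem $$-\Delta u=e^{2u}\ \text{ in }\mathbb D,\qquad \frac{\partial u}{\partial \nu}+\lambda=e^{u}\ \text{ on }\mathbb S^1. \qquad (P_\lambda)$$ The following hold. (i) If $\lambda\le 0$, then $(P_\lambda)$ has no solution $u\in C^\infty(\overline{\mathbb D})$. (ii) If $0<\lambda\le 2$ and $\lambda\neq 1$, then every solution $u\in C^\infty(\overline{\mathbb D})$ of $(P_\lambda)$ is of the form $$u(z)=\log\frac{2R}{1+R^2|z|^2},$$ where $R>0$ is the unique positive solution of $$(\lambda-2)R^2-2R+\lambda=0.$$
   Context: $\mathbb D=\{z\in\mathbb C:|z|<1\}$ is the open unit disk, $\mathbb S^1=\partial\mathbb D$, $\nu$ is the outer unit normal on $\mathbb S^1$, and $\Delta$ is the Euclidean Laplacian. $C^\infty(\overline{\mathbb D})$ denotes functions smooth up to the boundary. *)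

(* Defs.v *)
From Stdlib Require Import Reals.
From Coquelicot Require Import Coquelicot.
Open Scope R_scope.

Definition unit_disk (z : C) : Prop := Cmod z < 1.
Definition closed_unit_disk (z : C) : Prop := Cmod z <= 1.
Definition unit_circle (z : C) : Prop := Cmod z = 1.

(* The mixed partial derivative d^(m+k) u / dx^m dy^k at z = x + i y. *)
Definition partial (m k : nat) (u : C -> R) (z : C) : R :=
  partial_derive m k (fun x y => u (x, y)) (Re z) (Im z).

(* Members of C^oo of the closed disk are represented by total functions on C;
   only their values on the closed disk matter.  The function is C^oo in the
   open disk, every partial derivative extends continuously to the closed disk,
   and the values on the circle are those of the continuous extension of u. *)
Definition smooth_closed_disk (u : C -> R) : Prop :=
  (forall (n : nat) (z : C), unit_disk z ->
     ex_diff_n (fun x y => u (x, y)) n (Re z) (Im z)) /\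
  continuous_on closed_unit_disk u /\
  (forall m k : nat, exists g : C -> R,
     continuous_on closed_unit_disk g /\
     (forall z : C, unit_disk z -> g z = partial m k u z)).

Definition laplacian (u : C -> R) (z : C) : R :=
  partial 2 0 u z + partial 0 2 u z.

(* The outer unit normal of the disk at a point z of the circle is z itself.
   As u is only meaningful on the closed disk, the derivative at z in the
   direction z is the limit of difference quotients with steps t < 0. *)
Definition is_normal_derive (u : C -> R) (z : C) (l : R) : Prop :=
  filterlim (fun t : R => (u (Cplus z (Cmult (RtoC t) z)) - u z) / t)
    (at_left 0) (locally l).

Definition solves_P (lambda : R) (u : C -> R) : Prop :=
  (forall z : C, unit_disk z -> - laplacian u z = exp (2 * u z)) /\
  (forall z : C, unit_circle z ->
     exists l : R, is_normal_derive u z l /\ l + lambda = exp (u z)).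

(* Main.v *)
Require Import Defs.
From Stdlib Require Import Reals.
From Coquelicot Require Import Coquelicot.
From Stdlib Require Import Lra Psatz ClassicalEpsilon.
Open Scope R_scope.

(** Write [f = e^(-u)] and [mu = 1 - lambda].  By the equation the Hopf differential
    [phi = u_zz - u_z^2] is holomorphic, and differentiating the boundary condition along
    the circle gives [Im (z^2 phi) = (mu / 2) u_theta] there.  Hence the harmonic extension
    [h] of the boundary values of [u] satisfies [h_z = - z phi / mu], and integrating the
    divergences of [z phi e^(-h)] and of [phi ((1 - r^2) f_zbar + z f)], which have the same
    flux through the circle, yields
      [int (1/mu) r^2 |phi|^2 e^(-h) + int (1 - r^2) |phi|^2 f = 0].
    If [mu > 0] this forces [phi = 0].  If [-1 <= mu < 0], then [e^(-h) >= f] because [u] is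
    superharmonic, so [int (1 - 2 r^2) |phi|^2 f >= 0]; but this integral equals
    [- 1/8 int (1 - r^2)^2 Lap (|phi|^2 f)], and [Lap (|phi|^2 f) >= |phi|^2 e^u], so again
    [phi = 0].  Then [f] is a quadratic polynomial [a + d |z|^2], and the equation and the
    boundary condition determine its coefficients. *)

(** * Functions of class [C^1] on the open disk *)

(** Partial derivatives of a solution have no meaning on the circle itself, where only their
    continuous extensions exist. The argument therefore stays in the open disk: boundary data enter
    as uniform limits, and integrals over the disk are replaced by the flux of an explicit vector
    field through circles of radius r < 1. A field with nonnegative divergence whose radial part
    tends to 0 at the rim has zero divergence, so every integral identity amounts to the choice of a
    field. The choice rests on f_zz = - phi f. In (1 - r^2) f_zbar + z f the second term cancels the
    derivative of the weight, so that d/dzbar leaves only (1 - r^2) f_zbarzbar = - (1 - r^2)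
    conj(phi) f. On the circle z f may be traded for z e^(-h), and d/dzbar e^(-h) = conj(z phi)
    e^(-h) / mu is again a multiple of conj(phi). *)

Definition has_grad (F Fx Fy : R -> R -> R) : Prop :=
  forall x y, x ^ 2 + y ^ 2 < 1 ->
    is_derive (fun t => F t y) x (Fx x y) /\
    is_derive (fun t => F x t) y (Fy x y) /\
    continuity_2d_pt F x y /\
    continuity_2d_pt Fx x y /\
    continuity_2d_pt Fy x y.

Local Ltac split5 := split; [|split; [|split; [|split]]].

Lemma disk_open x y :
  x ^ 2 + y ^ 2 < 1 -> locally_2d (fun u v => u ^ 2 + v ^ 2 < 1) x y.
Proof.
intros h.
assert (c : continuity_2d_pt (fun u v => u * u + v * v) x y).
{ apply continuity_2d_pt_plus; apply continuity_2d_pt_mult;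
  (apply continuity_2d_pt_id1 || apply continuity_2d_pt_id2). }
assert (e : 0 < 1 - (x ^ 2 + y ^ 2)) by lra.
destruct (c (mkposreal _ e)) as [d hd]; exists d; intros u v hu hv.
specialize (hd u v hu hv); simpl in hd.
apply Rabs_def2 in hd; nra.
Qed.

Lemma disk_open_x x y : x ^ 2 + y ^ 2 < 1 -> locally x (fun t => t ^ 2 + y ^ 2 < 1).
Proof.
intros h; destruct (disk_open x y h) as [d hd]; exists d; intros t ht.
apply hd; [exact ht | rewrite Rminus_diag, Rabs_R0; apply cond_pos].
Qed.

Lemma disk_open_y x y : x ^ 2 + y ^ 2 < 1 -> locally y (fun t => x ^ 2 + t ^ 2 < 1).
Proof.
intros h; destruct (disk_open x y h) as [d hd]; exists d; intros t ht.
apply hd; [rewrite Rminus_diag, Rabs_R0; apply cond_pos | exact ht].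
Qed.

Lemma continuity_2d_pt_disk_ext f g x y :
  (forall u v, u ^ 2 + v ^ 2 < 1 -> f u v = g u v) -> x ^ 2 + y ^ 2 < 1 ->
  continuity_2d_pt f x y -> continuity_2d_pt g x y.
Proof.
intros e h; apply continuity_2d_pt_ext_loc.
destruct (disk_open x y h) as [d hd]; exists d; auto.
Qed.

Lemma grad_ext F Fx Fy G Gx Gy :
  has_grad F Fx Fy ->
  (forall x y, x ^ 2 + y ^ 2 < 1 ->
     F x y = G x y /\ Fx x y = Gx x y /\ Fy x y = Gy x y) ->
  has_grad G Gx Gy.
Proof.
intros c e x y h; destruct (c x y h) as (d1 & d2 & c0 & c1 & c2).
split5.
- rewrite <- (proj1 (proj2 (e x y h))).
  refine (is_derive_ext_loc _ _ _ _ _ d1).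
  refine (filter_imp _ _ _ (disk_open_x x y h)); intros t ht; now apply e.
- rewrite <- (proj2 (proj2 (e x y h))).
  refine (is_derive_ext_loc _ _ _ _ _ d2).
  refine (filter_imp _ _ _ (disk_open_y x y h)); intros t ht; now apply e.
- apply continuity_2d_pt_disk_ext with (3 := c0); [apply e | exact h].
- apply continuity_2d_pt_disk_ext with (3 := c1); [apply e | exact h].
- apply continuity_2d_pt_disk_ext with (3 := c2); [apply e | exact h].
Qed.

Lemma grad_const c : has_grad (fun _ _ => c) (fun _ _ => 0) (fun _ _ => 0).
Proof.
intros x y h; split5; try apply continuity_2d_pt_const;
  apply (is_derive_const c).
Qed.

Lemma grad_fst : has_grad (fun x _ => x) (fun _ _ => 1) (fun _ _ => 0).
Proof.
intros x y h; split5; try apply continuity_2d_pt_const.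
- apply (is_derive_id x).
- apply (is_derive_const x).
- apply continuity_2d_pt_id1.
Qed.

Lemma grad_snd : has_grad (fun _ y => y) (fun _ _ => 0) (fun _ _ => 1).
Proof.
intros x y h; split5; try apply continuity_2d_pt_const.
- apply (is_derive_const y).
- apply (is_derive_id y).
- apply continuity_2d_pt_id2.
Qed.

Lemma grad_plus F Fx Fy G Gx Gy :
  has_grad F Fx Fy -> has_grad G Gx Gy ->
  has_grad (fun x y => F x y + G x y) (fun x y => Fx x y + Gx x y)
     (fun x y => Fy x y + Gy x y).
Proof.
intros cF cG x y h.
destruct (cF x y h) as (a1 & a2 & a3 & a4 & a5).
destruct (cG x y h) as (b1 & b2 & b3 & b4 & b5).
split5; try (now apply continuity_2d_pt_plus).
- now apply (is_derive_plus (fun t => F t y) (fun t => G t y)).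
- now apply (is_derive_plus (fun t => F x t) (fun t => G x t)).
Qed.

Lemma grad_mult F Fx Fy G Gx Gy :
  has_grad F Fx Fy -> has_grad G Gx Gy ->
  has_grad (fun x y => F x y * G x y) (fun x y => Fx x y * G x y + F x y * Gx x y)
     (fun x y => Fy x y * G x y + F x y * Gy x y).
Proof.
intros cF cG x y h.
destruct (cF x y h) as (a1 & a2 & a3 & a4 & a5).
destruct (cG x y h) as (b1 & b2 & b3 & b4 & b5).
split5; repeat apply continuity_2d_pt_plus; repeat apply continuity_2d_pt_mult;
  trivial.
- apply (is_derive_mult (fun t => F t y) (fun t => G t y)); trivial; apply Rmult_comm.
- apply (is_derive_mult (fun t => F x t) (fun t => G x t)); trivial; apply Rmult_comm.
Qed.

Lemma grad_exp F Fx Fy :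
  has_grad F Fx Fy ->
  has_grad (fun x y => exp (F x y)) (fun x y => Fx x y * exp (F x y))
     (fun x y => Fy x y * exp (F x y)).
Proof.
intros cF x y h; destruct (cF x y h) as (a1 & a2 & a3 & a4 & a5).
assert (ce : continuity_2d_pt (fun u v => exp (F u v)) x y).
{ apply continuity_1d_2d_pt_comp; [apply derivable_continuous, derivable_exp | exact a3]. }
split5; try (now apply continuity_2d_pt_mult); trivial.
- apply (is_derive_comp exp (fun t => F t y)); [apply is_derive_exp | exact a1].
- apply (is_derive_comp exp (fun t => F x t)); [apply is_derive_exp | exact a2].
Qed.

Lemma grad_opp F Fx Fy :
  has_grad F Fx Fy ->
  has_grad (fun x y => - F x y) (fun x y => - Fx x y) (fun x y => - Fy x y).
Proof.
intros c; apply grad_ext with (1 := grad_mult _ _ _ _ _ _ (grad_const (-1)) c).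
intros; repeat split; ring.
Qed.

Lemma grad_minus F Fx Fy G Gx Gy :
  has_grad F Fx Fy -> has_grad G Gx Gy ->
  has_grad (fun x y => F x y - G x y) (fun x y => Fx x y - Gx x y)
     (fun x y => Fy x y - Gy x y).
Proof.
intros cF cG; apply grad_ext with (1 := grad_plus _ _ _ _ _ _ cF (grad_opp _ _ _ cG)).
intros; repeat split; ring.
Qed.

Lemma grad_differentiable F Fx Fy x y :
  has_grad F Fx Fy -> x ^ 2 + y ^ 2 < 1 ->
  differentiable_pt_lim F x y (Fx x y) (Fy x y).
Proof.
intros c h; apply filterdiff_differentiable_pt_lim.
destruct (c x y h) as (d1 & d2 & c0 & c1 & c2).
apply (is_derive_filterdiff F x y Fx (Fy x y)).
- apply (locally_2d_locally (fun u v => is_derive (fun t => F t v) u (Fx u v))).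
  destruct (disk_open x y h) as [d hd]; exists d.
  intros u v hu hv; now apply c, hd.
- exact d2.
- now apply continuity_2d_pt_filterlim.
Qed.

Lemma grad_comp F Fx Fy (f g : R -> R) t lf lg :
  has_grad F Fx Fy -> f t ^ 2 + g t ^ 2 < 1 ->
  is_derive f t lf -> is_derive g t lg ->
  is_derive (fun t => F (f t) (g t)) t (Fx (f t) (g t) * lf + Fy (f t) (g t) * lg).
Proof.
intros c h hf hg; apply is_derive_Reals.
apply derivable_pt_lim_comp_2d; try now apply is_derive_Reals.
now apply grad_differentiable.
Qed.

(** Continuity of [F] is a consequence: continuous partial derivatives make [F] differentiable. *)
Lemma grad_intro F Fx Fy :
  (forall x y, x ^ 2 + y ^ 2 < 1 -> is_derive (fun t => F t y) x (Fx x y)) ->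
  (forall x y, x ^ 2 + y ^ 2 < 1 -> is_derive (fun t => F x t) y (Fy x y)) ->
  (forall x y, x ^ 2 + y ^ 2 < 1 -> continuity_2d_pt Fx x y) ->
  (forall x y, x ^ 2 + y ^ 2 < 1 -> continuity_2d_pt Fy x y) ->
  has_grad F Fx Fy.
Proof.
intros h1 h2 c1 c2 x y h; split5; auto.
apply differentiable_continuity_pt; exists (Fx x y), (Fy x y).
apply filterdiff_differentiable_pt_lim.
apply (is_derive_filterdiff F x y Fx (Fy x y)); auto.
- apply (locally_2d_locally (fun u v => is_derive (fun t => F t v) u (Fx u v))).
  destruct (disk_open x y h) as [d hd]; exists d; auto.
- now apply continuity_2d_pt_filterlim, c1.
Qed.

Lemma grad_unique F Fx Fy Gx Gy x y :
  has_grad F Fx Fy -> has_grad F Gx Gy -> x ^ 2 + y ^ 2 < 1 -> Fx x y = Gx x y /\ Fy x y = Gy x y.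
Proof.
intros c d h; destruct (c x y h) as (a1 & a2 & _); destruct (d x y h) as (b1 & b2 & _).
split.
- now rewrite <- (is_derive_unique _ _ _ a1), <- (is_derive_unique _ _ _ b1).
- now rewrite <- (is_derive_unique _ _ _ a2), <- (is_derive_unique _ _ _ b2).
Qed.

Lemma grad_schwarz F Fx Fy Fxx Fxy Fyx Fyy x y :
  has_grad F Fx Fy -> has_grad Fx Fxx Fxy -> has_grad Fy Fyx Fyy -> x ^ 2 + y ^ 2 < 1 ->
  Fxy x y = Fyx x y.
Proof.
intros c cx cy h.
assert (ex : forall u v, u ^ 2 + v ^ 2 < 1 ->
  is_derive (fun z => Derive (fun t => F z t) v) u (Fyx u v)).
{ intros u v w; refine (is_derive_ext_loc _ _ _ _ _ (proj1 (cy u v w))).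
  refine (filter_imp _ _ _ (disk_open_x u v w)); intros z hz.
  symmetry; apply is_derive_unique, (c z v hz). }
assert (ey : forall u v, u ^ 2 + v ^ 2 < 1 ->
  is_derive (fun z => Derive (fun t => F t z) u) v (Fxy u v)).
{ intros u v w; refine (is_derive_ext_loc _ _ _ _ _ (proj1 (proj2 (cx u v w)))).
  refine (filter_imp _ _ _ (disk_open_y u v w)); intros z hz.
  symmetry; apply is_derive_unique, (c u z hz). }
rewrite <- (is_derive_unique _ _ _ (ex x y h)), <- (is_derive_unique _ _ _ (ey x y h)).
symmetry; apply Schwarz.
- destruct (disk_open x y h) as [d hd]; exists d; intros u v hu hv.
  specialize (hd u v hu hv).
  repeat split; eexists; [apply (c u v hd) | apply (c u v hd) | apply (ex u v hd)
    | apply (ey u v hd)].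
- apply (continuity_2d_pt_disk_ext Fyx); [|exact h | apply (cy x y h)].
  intros u v w; symmetry; apply is_derive_unique, (ex u v w).
- apply (continuity_2d_pt_disk_ext Fxy); [|exact h | apply (cx x y h)].
  intros u v w; symmetry; apply is_derive_unique, (ey u v w).
Qed.

Lemma grad_constant F x y :
  has_grad F (fun _ _ => 0) (fun _ _ => 0) -> x ^ 2 + y ^ 2 < 1 -> F x y = F 0 0.
Proof.
intros c h.
assert (hd : forall t, 0 <= t <= 1 -> is_derive (fun t => F (t * x) (t * y)) t 0).
{ intros t ht.
  evar_last; [apply (grad_comp F _ _ (fun t => t * x) (fun t => t * y) t x y c)
    | simpl; ring].
  - assert (t ^ 2 <= 1) by nra.
    assert (0 <= x ^ 2 + y ^ 2) by nra. nra.
  - auto_derive; trivial; ring.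
  - auto_derive; trivial; ring. }
destruct (MVT_gen (fun t => F (t * x) (t * y)) 0 1 (fun _ => 0)) as [t [_ ht]].
- rewrite Rmin_left, Rmax_right by lra; intros t ht; apply hd; lra.
- rewrite Rmin_left, Rmax_right by lra; intros t ht.
  apply continuity_pt_filterlim, (ex_derive_continuous (fun t => F (t * x) (t * y))).
  exists 0; now apply hd.
- rewrite !Rmult_1_l, !Rmult_0_l in ht; lra.
Qed.

Lemma continuous_2d_fst F x y :
  continuity_2d_pt F x y -> continuous (fun t => F t y) x.
Proof.
intros c; apply continuity_pt_filterlim, continuity_pt_locally; intros eps.
destruct (c eps) as [d hd]; exists d; intros t ht.
apply hd; [exact ht | rewrite Rminus_diag, Rabs_R0; apply cond_pos].
Qed.

Lemma continuous_2d_snd F x y :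
  continuity_2d_pt F x y -> continuous (fun t => F x t) y.
Proof.
intros c; apply continuity_pt_filterlim, continuity_pt_locally; intros eps.
destruct (c eps) as [d hd]; exists d; intros t ht.
apply hd; [rewrite Rminus_diag, Rabs_R0; apply cond_pos | exact ht].
Qed.

Lemma between_sqr y t : Rmin 0 y <= t <= Rmax 0 y -> t ^ 2 <= y ^ 2.
Proof.
unfold Rmin, Rmax; destruct (Rle_dec 0 y); intros; nra.
Qed.

(** The potential is the line integral of [A dx + B dy] from the origin along the horizontal axis to
    [(x, 0)] and then vertically to [(x, y)], a path that stays in the disk. *)
Lemma poincare A Ax Ay B Bx By :
  has_grad A Ax Ay -> has_grad B Bx By ->
  (forall x y, x ^ 2 + y ^ 2 < 1 -> Ay x y = Bx x y) ->
  exists H, has_grad H A B.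
Proof.
intros cA cB e.
exists (fun x y => RInt (fun t => A t 0) 0 x + RInt (fun t => B x t) 0 y).
assert (iB : forall x y, x ^ 2 + y ^ 2 < 1 -> ex_RInt (fun t => B x t) 0 y).
{ intros x y h; apply (ex_RInt_continuous (V := R_CompleteNormedModule)); intros t ht.
  apply between_sqr in ht; apply (continuous_2d_snd B), cB; lra. }
apply grad_intro.
- intros x y h.
  assert (dB : is_derive (fun x => RInt (fun t => B x t) 0 y) x
    (RInt (fun t => Derive (fun z => B z t) x) 0 y)).
  { apply is_derive_RInt_param.
    - refine (filter_imp _ _ _ (disk_open_x x y h)); intros z hz t ht.
      apply between_sqr in ht; eexists; apply (cB z t); lra.
    - intros t ht; apply between_sqr in ht.
      apply (continuity_2d_pt_disk_ext Bx); [|lra|apply cB; lra].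
      intros u v w; symmetry; apply is_derive_unique, (cB u v w).
    - refine (filter_imp _ _ _ (disk_open_x x y h)); intros z hz; now apply iB. }
  evar_last.
  + apply (is_derive_plus (fun x => RInt (fun t => A t 0) 0 x)
      (fun x => RInt (fun t => B x t) 0 y)); [|exact dB].
    apply (is_derive_RInt (fun t => A t 0) (fun x => RInt (fun t => A t 0) 0 x) 0).
    * assert (h0 : x ^ 2 + 0 ^ 2 < 1) by nra.
      refine (filter_imp _ _ _ (disk_open_x x 0 h0)); intros z hz.
      apply (RInt_correct (fun t => A t 0)).
      apply (ex_RInt_continuous (V := R_CompleteNormedModule)); intros t ht.
      apply between_sqr in ht; apply (continuous_2d_fst A), cA; lra.
    * apply (continuous_2d_fst A), cA; nra.
  (* Closedness turns the integrand [Bx x t] into [Ay x t]; the integral telescopes, and [A x 0]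
     cancels against the horizontal leg. *)
  + assert (r : RInt (fun t => Derive (fun z => B z t) x) 0 y = A x y - A x 0).
    { rewrite (RInt_ext _ (fun t => Ay x t)).
      - apply is_RInt_unique, (is_RInt_derive (fun t => A x t)); intros t ht;
          apply between_sqr in ht; [apply cA; lra | apply (continuous_2d_snd Ay), cA; lra].
      - intros t ht; rewrite e.
        + apply is_derive_unique, cB.
          assert (t ^ 2 <= y ^ 2) by (apply between_sqr; lra); lra.
        + assert (t ^ 2 <= y ^ 2) by (apply between_sqr; lra); lra. }
    rewrite r; unfold plus; simpl; ring.
- intros x y h; evar_last.
  + apply (is_derive_plus (fun _ => RInt (fun t => A t 0) 0 x)
      (fun y => RInt (fun t => B x t) 0 y)); [apply is_derive_const|].
    apply (is_derive_RInt (fun t => B x t) (fun y => RInt (fun t => B x t) 0 y) 0).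
    * refine (filter_imp _ _ _ (disk_open_y x y h)); intros z hz.
      now apply (RInt_correct (fun t => B x t)), iB.
    * now apply (continuous_2d_snd B), cB.
  + apply plus_zero_l.
- intros x y h; now apply cA.
- intros x y h; now apply cB.
Qed.

(** * The divergence theorem on circles *)

Lemma polar x y : exists r t, 0 <= r /\ - PI <= t <= PI /\ x = r * cos t /\ y = r * sin t.
Proof.
assert (hpi := PI_RGT_0).
set (r := sqrt (x ^ 2 + y ^ 2)).
assert (hr : r * r = x ^ 2 + y ^ 2) by (apply sqrt_sqrt; nra).
assert (h0 : 0 <= r) by apply sqrt_pos.
destruct (Req_dec r 0) as [z|nz].
{ exists 0, 0; rewrite z in hr; repeat split; try lra; nra. }
assert (hx : -1 <= x / r <= 1).
{ split; [apply Rle_div_r | apply Rle_div_l]; try lra; nra. }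
assert (hs : sqrt (1 - (x / r)²) = Rabs y / r).
{ replace (1 - (x / r)²) with ((Rabs y / r) ^ 2).
  - rewrite <- Rsqr_pow2; apply sqrt_Rsqr, Rdiv_le_0_compat; [apply Rabs_pos | lra].
  - unfold Rsqr; replace ((Rabs y / r) ^ 2) with ((Rabs y) ^ 2 / (r * r)) by (field; lra).
    rewrite pow2_abs; replace (y ^ 2) with (r * r - x ^ 2) by lra; field; lra. }
assert (b := acos_bound (x / r)).
destruct (Rle_dec 0 y) as [hy|hy].
- exists r, (acos (x / r)); repeat split; try lra.
  + rewrite cos_acos by exact hx; field; lra.
  + rewrite sin_acos, hs, Rabs_right by lra; field; lra.
- exists r, (- acos (x / r)); repeat split; try lra.
  + rewrite cos_neg, cos_acos by exact hx; field; lra.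
  + rewrite sin_neg, sin_acos, hs, Rabs_left by lra; field; lra.
Qed.

Lemma cos2_sin2 t : cos t ^ 2 + sin t ^ 2 = 1.
Proof. generalize (sin2_cos2 t); unfold Rsqr; intros; nra. Qed.

Lemma polar_norm r t : (r * cos t) ^ 2 + (r * sin t) ^ 2 = r ^ 2.
Proof.
replace ((r * cos t) ^ 2 + (r * sin t) ^ 2) with (r ^ 2 * (cos t ^ 2 + sin t ^ 2)) by ring.
rewrite cos2_sin2; ring.
Qed.

Lemma continuity_2d_pt_comp F f g x y :
  continuity_2d_pt F (f x y) (g x y) ->
  continuity_2d_pt f x y -> continuity_2d_pt g x y ->
  continuity_2d_pt (fun u v => F (f u v) (g u v)) x y.
Proof.
intros cF cf cg eps; destruct (cF eps) as [d hd].
destruct (cf d) as [d1 h1]; destruct (cg d) as [d2 h2].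
exists (mkposreal _ (Rmin_stable_in_posreal d1 d2)); simpl; intros u v hu hv.
apply hd.
- apply h1; eapply Rlt_le_trans; [exact hu | apply Rmin_l | exact hv | apply Rmin_l].
- apply h2; eapply Rlt_le_trans; [exact hu | apply Rmin_r | exact hv | apply Rmin_r].
Qed.

Lemma continuity_2d_pt_polar F r t :
  continuity_2d_pt F (r * cos t) (r * sin t) ->
  continuity_2d_pt (fun r t => F (r * cos t) (r * sin t)) r t.
Proof.
intros c; apply (continuity_2d_pt_comp F (fun r t => r * cos t) (fun r t => r * sin t));
  trivial; apply continuity_2d_pt_mult; try apply continuity_2d_pt_id1.
- apply (continuity_1d_2d_pt_comp cos); [apply continuity_cos | apply continuity_2d_pt_id2].
- apply (continuity_1d_2d_pt_comp sin); [apply continuity_sin | apply continuity_2d_pt_id2].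
Qed.

Lemma continuity_2d_pt_cos r t : continuity_2d_pt (fun _ t => cos t) r t.
Proof.
apply (continuity_1d_2d_pt_comp cos); [apply continuity_cos | apply continuity_2d_pt_id2].
Qed.

Lemma continuity_2d_pt_sin r t : continuity_2d_pt (fun _ t => sin t) r t.
Proof.
apply (continuity_1d_2d_pt_comp sin); [apply continuity_sin | apply continuity_2d_pt_id2].
Qed.

(** The starting angle [c] of the full turn is left free so that a prescribed point of the circle
    can lie strictly inside the interval of integration. *)
Definition flux (F G : R -> R -> R) (c r : R) : R :=
  RInt (fun t => r * cos t * F (r * cos t) (r * sin t)
    + r * sin t * G (r * cos t) (r * sin t)) c (c + 2 * PI).

Lemma sqr_lt_1 r : -1 < r < 1 -> r ^ 2 < 1.
Proof. intros; nra. Qed.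

Lemma flux_integrable F G c r Fx Fy Gx Gy :
  has_grad F Fx Fy -> has_grad G Gx Gy -> -1 < r < 1 ->
  ex_RInt (fun t => r * cos t * F (r * cos t) (r * sin t)
    + r * sin t * G (r * cos t) (r * sin t)) c (c + 2 * PI).
Proof.
intros cF cG hr; apply (ex_RInt_continuous (V := R_CompleteNormedModule)); intros t ht.
apply (continuous_2d_snd (fun r t => r * cos t * F (r * cos t) (r * sin t)
  + r * sin t * G (r * cos t) (r * sin t))).
assert (h := polar_norm r t); apply sqr_lt_1 in hr.
apply continuity_2d_pt_plus; repeat apply continuity_2d_pt_mult;
  try apply continuity_2d_pt_id1; try apply continuity_2d_pt_cos;
  try apply continuity_2d_pt_sin; apply (continuity_2d_pt_polar).
- apply cF; lra.
- apply cG; lra.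
Qed.

(** Radii range over [(-1, 1)] so that the derivative is two-sided at 0, where the monotonicity of
    the flux starts. *)
Lemma is_derive_flux F Fx Fy G Gx Gy c r :
  has_grad F Fx Fy -> has_grad G Gx Gy -> -1 < r < 1 ->
  is_derive (flux F G c) r
    (RInt (fun t => r * (Fx (r * cos t) (r * sin t) + Gy (r * cos t) (r * sin t)))
       c (c + 2 * PI)).
Proof.
intros cF cG hr.
set (f := fun r t => r * cos t * F (r * cos t) (r * sin t)
  + r * sin t * G (r * cos t) (r * sin t)).
set (df := fun r t =>
  cos t * F (r * cos t) (r * sin t)
  + r * cos t * (Fx (r * cos t) (r * sin t) * cos t + Fy (r * cos t) (r * sin t) * sin t)
  + (sin t * G (r * cos t) (r * sin t)
  + r * sin t * (Gx (r * cos t) (r * sin t) * cos t + Gy (r * cos t) (r * sin t) * sin t))).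
assert (lr : forall r t, -1 < r < 1 -> (r * cos t) ^ 2 + (r * sin t) ^ 2 < 1).
{ intros s t hs; rewrite polar_norm; now apply sqr_lt_1. }
assert (nr : locally r (fun s => -1 < s < 1)).
{ apply filter_and; [now apply open_gt | now apply open_lt]. }
assert (pc : forall (h : R -> R) s t l, is_derive h s l ->
  is_derive (fun s => s * cos t * h s) s (cos t * h s + s * cos t * l)).
{ intros h s t l hd; apply (is_derive_mult (fun s => s * cos t) h); trivial;
    [|apply Rmult_comm]; auto_derive; trivial; ring. }
assert (ps : forall (h : R -> R) s t l, is_derive h s l ->
  is_derive (fun s => s * sin t * h s) s (sin t * h s + s * sin t * l)).
{ intros h s t l hd; apply (is_derive_mult (fun s => s * sin t) h); trivial;
    [|apply Rmult_comm]; auto_derive; trivial; ring. }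
assert (d : forall s t, -1 < s < 1 -> is_derive (fun s => f s t) s (df s t)).
{ intros s t hs; unfold f, df.
  apply (is_derive_plus (fun s => s * cos t * F (s * cos t) (s * sin t))
    (fun s => s * sin t * G (s * cos t) (s * sin t))).
  - apply (pc (fun s => F (s * cos t) (s * sin t))), (grad_comp F _ _ (fun s => s * cos t) (fun s => s * sin t) s); auto;
      auto_derive; trivial; ring.
  - apply (ps (fun s => G (s * cos t) (s * sin t))), (grad_comp G _ _ (fun s => s * cos t) (fun s => s * sin t) s); auto;
      auto_derive; trivial; ring. }
assert (cdf : forall t, continuity_2d_pt df r t).
{ intros t; unfold df.
  assert (k := lr r t hr).
  repeat apply continuity_2d_pt_plus; repeat apply continuity_2d_pt_mult;
  repeat apply continuity_2d_pt_plus; repeat apply continuity_2d_pt_mult;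
  try apply continuity_2d_pt_id1; try apply continuity_2d_pt_cos;
  try apply continuity_2d_pt_sin; apply continuity_2d_pt_polar;
  first [apply cF | apply cG]; exact k. }
assert (D : is_derive (flux F G c) r
  (RInt (fun t => Derive (fun s => f s t) r) c (c + 2 * PI))).
{ apply (is_derive_RInt_param f).
  - refine (filter_imp _ _ _ nr); intros s hs t _; eexists; now apply d.
  - intros t _; refine (continuity_2d_pt_ext_loc _ _ _ _ _ (cdf t)).
    destruct nr as [e he]; exists e; intros s v hs _.
    symmetry; now apply is_derive_unique, d, he.
  - refine (filter_imp _ _ _ nr); intros s hs.
    now apply (flux_integrable F G c s Fx Fy Gx Gy). }
evar_last; [exact D|].
(* [d/dr (r F.n) + d/dt (F.tau) = r div F], and the tangential term integrates to zero. *)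
set (q := fun t => - sin t * F (r * cos t) (r * sin t) + cos t * G (r * cos t) (r * sin t)).
set (dq := fun t => r * (Fx (r * cos t) (r * sin t) + Gy (r * cos t) (r * sin t)) - df r t).
assert (hq : forall t, is_derive q t (dq t)).
{ intros t; evar_last.
  - apply (is_derive_plus (fun t => - sin t * F (r * cos t) (r * sin t))
      (fun t => cos t * G (r * cos t) (r * sin t))).
    + apply (is_derive_mult (fun t => - sin t) (fun t => F (r * cos t) (r * sin t)));
        [| |apply Rmult_comm].
      * auto_derive; trivial.
      * apply (grad_comp F Fx Fy (fun t => r * cos t) (fun t => r * sin t) t); auto; auto_derive; trivial.
    + apply (is_derive_mult (fun t => cos t) (fun t => G (r * cos t) (r * sin t)));
        [| |apply Rmult_comm].
      * auto_derive; trivial.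
      * apply (grad_comp G Gx Gy (fun t => r * cos t) (fun t => r * sin t) t); auto; auto_derive; trivial.
  - unfold dq, df, plus, mult; simpl.
    assert (e : cos t ^ 2 = 1 - sin t ^ 2) by (generalize (cos2_sin2 t); lra).
    ring [e]. }
assert (cd : forall t, continuous (fun t => r * (Fx (r * cos t) (r * sin t)
    + Gy (r * cos t) (r * sin t))) t).
{ intros t; apply (continuous_2d_snd (fun r t => r * (Fx (r * cos t) (r * sin t)
    + Gy (r * cos t) (r * sin t)))).
  assert (k := lr r t hr).
  apply continuity_2d_pt_mult; [apply continuity_2d_pt_id1|].
  apply continuity_2d_pt_plus; apply continuity_2d_pt_polar; [now apply cF | now apply cG]. }
assert (cf : forall t, continuous (df r) t).
{ intros t; apply (continuous_2d_snd df), cdf. }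
assert (i : RInt dq c (c + 2 * PI) = q (c + 2 * PI) - q c).
{ apply is_RInt_unique, (is_RInt_derive (V := R_CompleteNormedModule) q dq); intros t _; [apply hq|].
  apply (continuous_minus _ (df r)); auto. }
unfold dq in i.
rewrite (RInt_minus (V := R_CompleteNormedModule)) in i;
  try (apply (ex_RInt_continuous (V := R_CompleteNormedModule)); auto).
rewrite (RInt_ext _ (df r)).
- unfold minus, plus, opp in i; simpl in i.
  assert (z : q (c + 2 * PI) = q c) by (unfold q; rewrite cos_plus, sin_plus, cos_2PI, sin_2PI; rewrite !Rmult_1_r, !Rmult_0_r, Rminus_0_r, Rplus_0_r; reflexivity).
  rewrite z in i; lra.
- intros t _; apply is_derive_unique; auto.
Qed.

(** Uniform convergence to 0 on approach to the circle; nothing is said about values on it. The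
    threshold [r0] bounds the squared radius. *)
Definition vanishes_at_rim (g : R -> R -> R) : Prop :=
  forall eps, 0 < eps -> exists r0, 0 <= r0 < 1 /\
    forall x y, r0 < x ^ 2 + y ^ 2 < 1 -> Rabs (g x y) < eps.

(** The primitive from [a] is squeezed between 0 and the total integral, so it vanishes identically,
    and with it its derivative [g]. *)
Lemma RInt_nonneg_zero (g : R -> R) a b t :
  (forall s, continuous g s) -> (forall s, 0 <= g s) -> a < t < b -> RInt g a b = 0 ->
  g t = 0.
Proof.
intros c p h e.
assert (i : forall u v, ex_RInt g u v).
{ intros u v; apply (ex_RInt_continuous (V := R_CompleteNormedModule)); auto. }
assert (z : forall s, a < s < b -> RInt g a s = 0).
{ intros s hs.
  assert (h1 : 0 <= RInt g a s) by (apply RInt_ge_0; auto; lra).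
  assert (h2 : 0 <= RInt g s b) by (apply RInt_ge_0; auto; lra).
  assert (ch := RInt_Chasles g a s b (i a s) (i s b)); unfold plus in ch; simpl in ch; lra. }
assert (d : is_derive (fun s => RInt g a s) t (g t)).
{ apply (is_derive_RInt g (fun s => RInt g a s) a); auto.
  apply filter_forall; intros s; now apply (RInt_correct g). }
assert (d0 : is_derive (fun s => RInt g a s) t 0).
{ apply (is_derive_ext_loc (fun _ => 0)); [|apply (is_derive_const 0)].
  assert (n : locally t (fun s => a < s < b)).
  { apply filter_and; [now apply open_gt | now apply open_lt]. }
  refine (filter_imp _ _ _ n); intros s hs; symmetry; now apply z. }
now rewrite <- (is_derive_unique _ _ _ d), (is_derive_unique _ _ _ d0).
Qed.

Lemma derivable_nondecreasing (f df : R -> R) a b :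
  a <= b -> (forall t, a <= t <= b -> is_derive f t (df t)) ->
  (forall t, a <= t <= b -> 0 <= df t) -> f a <= f b.
Proof.
intros h d p; destruct (MVT_gen f a b df) as [t [ht e]].
- rewrite Rmin_left, Rmax_right by lra; intros; apply d; lra.
- rewrite Rmin_left, Rmax_right by lra; intros; apply continuity_pt_filterlim.
  apply (ex_derive_continuous f); eexists; apply d; lra.
- rewrite Rmin_left, Rmax_right in ht by lra.
  assert (q := p t ht); nra.
Qed.

(* The flux through the circle of radius [r] is nondecreasing in [r]; as it vanishes at
   both ends it is constant. *)
Lemma divergence_zero F Fx Fy G Gx Gy :
  has_grad F Fx Fy -> has_grad G Gx Gy ->
  (forall x y, x ^ 2 + y ^ 2 < 1 -> 0 <= Fx x y + Gy x y) ->
  vanishes_at_rim (fun x y => x * F x y + y * G x y) ->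
  forall x y, x ^ 2 + y ^ 2 < 1 -> (x <> 0 \/ y <> 0) -> Fx x y + Gy x y = 0.
Proof.
intros cF cG p v x y h nz.
assert (hpi := PI_RGT_0).
destruct (polar x y) as (r & t0 & hr & ht0 & ex & ey).
assert (n := polar_norm r t0); rewrite <- ex, <- ey in n.
assert (hr0 : r <> 0) by (intros z; subst; destruct nz as [nz|nz]; apply nz; ring).
assert (hr1 : 0 < r < 1) by (split; [lra | nra]).
(* This places [t0] at the midpoint of the interval of integration, as [RInt_nonneg_zero] needs an
   interior point. *)
set (c := t0 - PI).
set (d := fun r t => Fx (r * cos t) (r * sin t) + Gy (r * cos t) (r * sin t)).
assert (lr : forall r t, -1 < r < 1 -> (r * cos t) ^ 2 + (r * sin t) ^ 2 < 1).
{ intros s t hs; rewrite polar_norm; now apply sqr_lt_1. }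
assert (cd : forall s t, -1 < s < 1 -> continuous (d s) t).
{ intros s t hs; apply (continuous_2d_snd d).
  apply continuity_2d_pt_plus; apply continuity_2d_pt_polar; [apply cF | apply cG]; auto. }
assert (pd : forall s t, -1 < s < 1 -> 0 <= d s t) by (intros; apply p; auto).
assert (dfl : forall s, -1 < s < 1 -> is_derive (flux F G c) s
  (s * RInt (d s) c (c + 2 * PI))).
{ intros s hs; evar_last; [now apply (is_derive_flux F Fx Fy G Gx Gy)|].
  apply (RInt_scal (V := R_CompleteNormedModule) (d s)).
  apply (ex_RInt_continuous (V := R_CompleteNormedModule)); auto. }
assert (pi : forall s, -1 < s < 1 -> 0 <= RInt (d s) c (c + 2 * PI)).
{ intros s hs; apply RInt_ge_0; [lra | | auto].
  apply (ex_RInt_continuous (V := R_CompleteNormedModule)); auto. }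
assert (mono : forall s s', 0 <= s -> s <= s' -> s' < 1 -> flux F G c s <= flux F G c s').
{ intros s s' h1 h2 h3.
  apply (derivable_nondecreasing _ (fun s => s * RInt (d s) c (c + 2 * PI))); trivial.
  - intros q hq; apply dfl; lra.
  - intros q hq; apply Rmult_le_pos; [|apply pi]; lra. }
assert (f0 : flux F G c 0 = 0).
{ unfold flux; rewrite (RInt_ext _ (fun _ => 0)).
  - rewrite RInt_const; apply Rmult_0_r.
  - intros t _; rewrite !Rmult_0_l; apply Rplus_0_r. }
assert (z : forall s, 0 <= s < 1 -> flux F G c s = 0).
{ intros s hs; apply Rle_antisym; [|rewrite <- f0; apply mono; lra].
  apply le_epsilon; intros e he; rewrite Rplus_0_l.
  (* The integrand gets below [e / (2 * PI)] on an interval of length [2 * PI]. As [r0] bounds a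
     squared radius, the comparison radius is the square root of a number between [r0] and 1. *)
  destruct (v (e / (2 * PI))) as [r0 [hr00 hv]]; [apply Rdiv_lt_0_compat; lra|].
  assert (hr2 : r0 < sqrt ((1 + r0) / 2) ^ 2 < 1) by (rewrite pow2_sqrt; lra).
  assert (hq := sqrt_pos ((1 + r0) / 2)).
  set (q := sqrt ((1 + r0) / 2)) in *.
  set (m := Rmax s q).
  assert (hm : s <= m /\ q <= m) by (split; [apply Rmax_l | apply Rmax_r]).
  assert (hm1 : m < 1) by (apply Rmax_lub_lt; [lra | nra]).
  apply Rle_trans with (flux F G c m); [apply mono; lra|].
  apply Rle_trans with (1 := Rle_abs _).
  replace e with ((c + 2 * PI - c) * (e / (2 * PI))) by (field; lra).
  apply abs_RInt_le_const; [lra | |].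
  - apply (flux_integrable F G c m Fx Fy Gx Gy); trivial; lra.
  - intros t _; apply Rlt_le, hv; rewrite polar_norm; nra. }
assert (d0 : is_derive (flux F G c) r 0).
{ apply (is_derive_ext_loc (fun _ => 0)); [|apply (is_derive_const 0)].
  assert (nn : locally r (fun s => 0 < s < 1)).
  { apply filter_and; [now apply open_gt | now apply open_lt]. }
  refine (filter_imp _ _ _ nn); intros s hs; symmetry; apply z; lra. }
assert (e : r * RInt (d r) c (c + 2 * PI) = 0).
{ rewrite <- (is_derive_unique _ _ _ d0); symmetry; apply is_derive_unique, dfl; lra. }
apply Rmult_integral in e; destruct e as [e|e]; [contradiction|].
rewrite ex, ey; apply (RInt_nonneg_zero (d r) c (c + 2 * PI)); trivial.
- intros; apply cd; lra.
- intros; apply pd; lra.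
- unfold c; lra.
Qed.

(** * Compactness: minima on rectangles *)

(** Two successive minimisations in one variable: uniform continuity on a strip makes the marginal
    minimum continuous in [x], although the chosen minimiser [Y] may jump. *)
Lemma min_on_rectangle (F : R -> R -> R) a b c d :
  a <= b -> c <= d -> (forall x y, continuity_2d_pt F x y) ->
  exists x0 y0, a <= x0 <= b /\ c <= y0 <= d /\
    forall x y, a <= x <= b -> c <= y <= d -> F x0 y0 <= F x y.
Proof.
intros hab hcd cF.
assert (ey : forall x, exists y, (forall y', c <= y' <= d -> F x y <= F x y') /\ c <= y <= d).
{ intros x; apply continuity_ab_min; trivial; intros y _.
  apply continuity_pt_filterlim, (continuous_2d_snd F), cF. }
set (Y := fun x => proj1_sig (constructive_indefinite_description _ (ey x))).
assert (hY : forall x, (forall y', c <= y' <= d -> F x (Y x) <= F x y') /\ c <= Y x <= d).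
{ intros x; exact (proj2_sig (constructive_indefinite_description _ (ey x))). }
destruct (continuity_ab_min (fun x => F x (Y x)) a b hab) as [x0 [h0 hx0]].
- intros x _; apply continuity_pt_locally; intros e.
  destruct (uniform_continuity_2d F (x - 1) (x + 1) c d (fun x y _ _ => cF x y) e) as [del hd].
  assert (p : 0 < Rmin del 1) by (apply Rmin_pos; [apply cond_pos | lra]).
  exists (mkposreal _ p); intros x' hx'.
  change (Rabs (x' - x) < Rmin del 1) in hx'.
  assert (k1 : Rabs (x' - x) < del) by (eapply Rlt_le_trans; [exact hx' | apply Rmin_l]).
  assert (k2 : Rabs (x' - x) < 1) by (eapply Rlt_le_trans; [exact hx' | apply Rmin_r]).
  apply Rabs_def2 in k2.
  assert (z : forall y, Rabs (y - y) < del).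
  { intros y; rewrite Rminus_diag, Rabs_R0; apply cond_pos. }
  destruct (hY x) as [m1 r1]; destruct (hY x') as [m2 r2].
  assert (u1 := hd x (Y x) x' (Y x) ltac:(lra) r1 ltac:(lra) r1 k1 (z _)).
  assert (u2 := hd x (Y x') x' (Y x') ltac:(lra) r2 ltac:(lra) r2 k1 (z _)).
  apply Rabs_def2 in u1; apply Rabs_def2 in u2.
  specialize (m1 (Y x') r2); specialize (m2 (Y x) r1).
  apply Rabs_def1; lra.
- exists x0, (Y x0); repeat split; try apply hY; try apply hx0.
  intros x y hx hy; apply Rle_trans with (F x (Y x)); [now apply h0 | now apply hY].
Qed.

(** * Minimum principle and behaviour at the rim *)

(** If [l < 0], the slope is below [df x] just to the right of [x] and above it just to the left. A
    step to the right when [df x <= 0], or to the left when [df x > 0], then lowers [f] by the mean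
    value theorem. *)
Lemma second_derivative_at_min (f df : R -> R) x l :
  locally x (fun t => is_derive f t (df t)) -> is_derive df x l ->
  locally x (fun t => f x <= f t) -> 0 <= l.
Proof.
intros [d1 h1] h2 [d2 h3].
destruct (Rle_lt_dec 0 l) as [hl|hl]; [exact hl|exfalso].
apply is_derive_Reals in h2.
destruct (h2 (- l) ltac:(lra)) as [d3 h4].
set (e := Rmin d1 (Rmin d2 d3) / 2).
assert (he : 0 < e /\ e < d1 /\ e < d2 /\ e < d3).
{ assert (p1 := cond_pos d1); assert (p2 := cond_pos d2); assert (p3 := cond_pos d3).
  assert (q1 := Rmin_l d1 (Rmin d2 d3)); assert (q2 := Rmin_r d1 (Rmin d2 d3)).
  assert (q3 := Rmin_l d2 d3); assert (q4 := Rmin_r d2 d3).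
  assert (0 < Rmin d1 (Rmin d2 d3)) by (repeat apply Rmin_pos; assumption).
  unfold e; lra. }
assert (slope : forall k, k <> 0 -> Rabs k < d3 -> (df (x + k) - df x) / k < 0).
{ intros k k0 hk; specialize (h4 k k0 hk); apply Rabs_def2 in h4; lra. }
assert (near : forall t, x - e <= t <= x + e -> derivable_pt_lim f t (df t)).
{ intros t ht; apply is_derive_Reals, h1; apply Rabs_def1; unfold minus, plus, opp; simpl; lra. }
assert (low : forall t, x - e <= t <= x + e -> f x <= f t).
{ intros t ht; apply h3; apply Rabs_def1; unfold minus, plus, opp; simpl; lra. }
destruct (Rle_lt_dec (df x) 0) as [s|s].
- destruct (MVT_cor2 f df x (x + e) ltac:(lra)) as [c [ec hc]].
  { intros; apply near; lra. }
  assert (v := slope (c - x) ltac:(lra) ltac:(apply Rabs_def1; lra)).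
  replace (x + (c - x)) with c in v by ring.
  apply Rmult_lt_compat_r with (r := c - x) in v; [|lra].
  unfold Rdiv in v; rewrite Rmult_assoc, Rinv_l in v by lra.
  specialize (low (x + e) ltac:(lra)); nra.
- destruct (MVT_cor2 f df (x - e) x ltac:(lra)) as [c [ec hc]].
  { intros; apply near; lra. }
  assert (v := slope (c - x) ltac:(lra) ltac:(apply Rabs_def1; lra)).
  replace (x + (c - x)) with c in v by ring.
  apply Rmult_lt_compat_r with (r := x - c) in v; [|lra].
  replace ((df c - df x) / (c - x) * (x - c)) with (df x - df c) in v by (field; lra).
  specialize (low (x - e) ltac:(lra)); nra.
Qed.

(** [Rmax a (Rmin r b)] projects [r] onto [[a, b]]. Composing with it yields functions continuous
    everywhere, the form in which [min_on_rectangle] takes them. *)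
Lemma clamp_bounds a b r : a <= b -> a <= Rmax a (Rmin r b) <= b.
Proof.
intros; split; [apply Rmax_l | apply Rmax_lub; [assumption | apply Rmin_r]].
Qed.

Lemma clamp_id a b r : a <= r <= b -> Rmax a (Rmin r b) = r.
Proof. intros; rewrite Rmin_left, Rmax_right; lra. Qed.

Lemma continuity_clamp a b r : continuity_pt (fun r => Rmax a (Rmin r b)) r.
Proof.
apply continuity_pt_locally; intros e; exists e; intros s hs.
change (Rabs (s - r) < e) in hs.
apply Rle_lt_trans with (2 := hs).
unfold Rmax, Rmin; destruct (Rle_dec s b), (Rle_dec r b); repeat destruct Rle_dec;
  unfold Rabs; repeat destruct Rcase_abs; lra.
Qed.

(** Were [K x y] negative, [K] would exceed [K x y / 2] near the rim, so its minimum over a smaller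
    closed disk would be a minimum over the whole open disk; both pure second derivatives would be
    nonnegative there. *)
Lemma superharmonic_nonneg K Kx Ky Kxx Kxy Kyx Kyy :
  has_grad K Kx Ky -> has_grad Kx Kxx Kxy -> has_grad Ky Kyx Kyy ->
  (forall x y, x ^ 2 + y ^ 2 < 1 -> Kxx x y + Kyy x y < 0) ->
  vanishes_at_rim K ->
  forall x y, x ^ 2 + y ^ 2 < 1 -> 0 <= K x y.
Proof.
intros cK cx cy neg v x y h.
destruct (Rle_lt_dec 0 (K x y)) as [k|k]; [exact k|exfalso].
destruct (v (- K x y / 2) ltac:(lra)) as [r0 [hr0 hv]].
set (s := sqrt r0).
assert (hs : 0 <= s) by apply sqrt_pos.
assert (hs2 : s ^ 2 = r0) by (apply pow2_sqrt; lra).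
assert (hs1 : s < 1) by nra.
set (cl := fun r => Rmax 0 (Rmin r s)).
assert (hpi := PI_RGT_0).
assert (hcl : forall r t, (cl r * cos t) ^ 2 + (cl r * sin t) ^ 2 < 1).
{ intros r t; rewrite polar_norm; apply sqr_lt_1; unfold cl.
  destruct (clamp_bounds 0 s r hs); lra. }
destruct (min_on_rectangle (fun r t => K (cl r * cos t) (cl r * sin t)) 0 s (- PI) PI)
  as (r1 & t1 & hr1 & ht1 & m); try lra.
{ intros r t.
  apply (continuity_2d_pt_comp (fun r t => K (r * cos t) (r * sin t))
    (fun r _ => cl r) (fun _ t => t)).
  - apply continuity_2d_pt_polar, cK, hcl.
  - apply (continuity_1d_2d_pt_comp cl); [apply continuity_clamp | apply continuity_2d_pt_id1].
  - apply continuity_2d_pt_id2. }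
set (x1 := cl r1 * cos t1) in m; set (y1 := cl r1 * sin t1) in m.
assert (h1 : x1 ^ 2 + y1 ^ 2 < 1) by apply hcl.
assert (inner : forall a b, a ^ 2 + b ^ 2 <= r0 -> K x1 y1 <= K a b).
{ intros a b hab; destruct (polar a b) as (r & t & hr & ht & ea & eb).
  assert (n := polar_norm r t); rewrite <- ea, <- eb in n.
  assert (r <= s) by nra.
  specialize (m r t ltac:(lra) ht); unfold cl in m; rewrite clamp_id in m by lra.
  now rewrite <- ea, <- eb in m. }
assert (hin : x ^ 2 + y ^ 2 <= r0).
{ destruct (Rle_lt_dec (x ^ 2 + y ^ 2) r0) as [q|q]; [exact q|exfalso].
  specialize (hv x y ltac:(lra)); apply Rabs_def2 in hv; lra. }
assert (all : forall a b, a ^ 2 + b ^ 2 < 1 -> K x1 y1 <= K a b).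
{ intros a b hab; destruct (Rle_lt_dec (a ^ 2 + b ^ 2) r0) as [q|q]; [now apply inner|].
  specialize (hv a b ltac:(lra)); apply Rabs_def2 in hv.
  specialize (inner x y hin); lra. }
assert (pxx : 0 <= Kxx x1 y1).
{ apply (second_derivative_at_min (fun t => K t y1) (fun t => Kx t y1) x1).
  - refine (filter_imp _ _ _ (disk_open_x x1 y1 h1)); intros t ht; now apply cK.
  - now apply cx.
  - refine (filter_imp _ _ _ (disk_open_x x1 y1 h1)); intros t ht; now apply all. }
assert (pyy : 0 <= Kyy x1 y1).
{ apply (second_derivative_at_min (fun t => K x1 t) (fun t => Ky x1 t) y1).
  - refine (filter_imp _ _ _ (disk_open_y x1 y1 h1)); intros t ht; now apply cK.
  - now apply cy.
  - refine (filter_imp _ _ _ (disk_open_y x1 y1 h1)); intros t ht; now apply all. }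
specialize (neg x1 y1 h1); lra.
Qed.

(** * Bounded functions and functions vanishing at the rim *)

Definition bounded_on_disk (g : R -> R -> R) : Prop :=
  exists M, forall x y, x ^ 2 + y ^ 2 < 1 -> Rabs (g x y) <= M.

Lemma bounded_const c : bounded_on_disk (fun _ _ => c).
Proof. exists (Rabs c); intros; lra. Qed.

Lemma bounded_fst : bounded_on_disk (fun x _ => x).
Proof. exists 1; intros; apply Rabs_le; nra. Qed.

Lemma bounded_snd : bounded_on_disk (fun _ y => y).
Proof. exists 1; intros; apply Rabs_le; nra. Qed.

Lemma bounded_plus f g :
  bounded_on_disk f -> bounded_on_disk g -> bounded_on_disk (fun x y => f x y + g x y).
Proof.
intros [M hM] [N hN]; exists (M + N); intros x y h.
apply Rle_trans with (1 := Rabs_triang _ _); apply Rplus_le_compat; auto.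
Qed.

Lemma bounded_opp f : bounded_on_disk f -> bounded_on_disk (fun x y => - f x y).
Proof. intros [M hM]; exists M; intros x y h; rewrite Rabs_Ropp; auto. Qed.

Lemma bounded_minus f g :
  bounded_on_disk f -> bounded_on_disk g -> bounded_on_disk (fun x y => f x y - g x y).
Proof. intros hf hg; apply bounded_plus; [|apply bounded_opp]; trivial. Qed.

Lemma bounded_mult f g :
  bounded_on_disk f -> bounded_on_disk g -> bounded_on_disk (fun x y => f x y * g x y).
Proof.
intros [M hM] [N hN]; exists (M * N); intros x y h; rewrite Rabs_mult.
apply Rmult_le_compat; auto using Rabs_pos.
Qed.

Lemma bounded_exp f : bounded_on_disk f -> bounded_on_disk (fun x y => exp (f x y)).
Proof.
intros [M hM]; exists (exp M); intros x y h.
rewrite Rabs_right by (apply Rle_ge, Rlt_le, exp_pos).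
specialize (hM x y h); assert (a := Rle_abs (f x y)).
destruct (Rle_lt_or_eq_dec (f x y) M ltac:(lra)) as [e|e];
  [apply Rlt_le, exp_increasing, e | rewrite e; lra].
Qed.

Lemma vanishes_plus f g :
  vanishes_at_rim f -> vanishes_at_rim g -> vanishes_at_rim (fun x y => f x y + g x y).
Proof.
intros hf hg e he.
destruct (hf (e / 2) ltac:(lra)) as [r [hr h1]].
destruct (hg (e / 2) ltac:(lra)) as [s [hs h2]].
exists (Rmax r s); split.
- split; [apply Rle_trans with r; [lra | apply Rmax_l] | apply Rmax_lub_lt; lra].
- intros x y h; assert (q1 := Rmax_l r s); assert (q2 := Rmax_r r s).
  apply Rle_lt_trans with (1 := Rabs_triang _ _).
  specialize (h1 x y ltac:(lra)); specialize (h2 x y ltac:(lra)); lra.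
Qed.

Lemma vanishes_mult f g :
  vanishes_at_rim f -> bounded_on_disk g -> vanishes_at_rim (fun x y => f x y * g x y).
Proof.
intros hf [M hM] e he.
assert (hM0 : 0 <= M) by (apply Rle_trans with (2 := hM 0 0 ltac:(lra)); apply Rabs_pos).
destruct (hf (e / (M + 1))) as [r [hr h1]]; [apply Rdiv_lt_0_compat; lra|].
exists r; split; [exact hr|]; intros x y h; rewrite Rabs_mult.
specialize (h1 x y h); specialize (hM x y ltac:(lra)).
apply Rle_lt_trans with (e / (M + 1) * M).
- apply Rmult_le_compat; try apply Rabs_pos; lra.
- apply Rmult_lt_reg_r with (M + 1); [lra|].
  replace (e / (M + 1) * M * (M + 1)) with (e * M) by (field; lra); nra.
Qed.

Lemma vanishes_ext f g :
  (forall x y, x ^ 2 + y ^ 2 < 1 -> f x y = g x y) ->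
  vanishes_at_rim f -> vanishes_at_rim g.
Proof.
intros e v eps he; destruct (v eps he) as [r [hr h]]; exists r; split; trivial.
intros x y hxy; rewrite <- e by lra; auto.
Qed.

Lemma vanishes_rim : vanishes_at_rim (fun x y => 1 - (x ^ 2 + y ^ 2)).
Proof.
intros e he; exists (Rmax 0 (1 - e)); split.
- split; [apply Rmax_l | apply Rmax_lub_lt; lra].
- intros x y h; assert (q := Rmax_r 0 (1 - e)); apply Rabs_def1; lra.
Qed.

Lemma vanishes_exp f : vanishes_at_rim f -> vanishes_at_rim (fun x y => exp (f x y) - 1).
Proof.
intros v e he.
assert (c : continuity_pt exp 0) by apply derivable_continuous, derivable_exp.
assert (c' := proj1 (continuity_pt_locally exp 0) c).
destruct (c' (mkposreal e he)) as [d hd].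
destruct (v d (cond_pos d)) as [r [hr h]]; exists r; split; trivial.
intros x y hxy; rewrite <- exp_0; apply hd.
change (Rabs (f x y - 0) < d); rewrite Rminus_0_r; auto.
Qed.

Lemma at_left_near (r : R) (P : R -> Prop) :
  r < 1 -> (forall x, r < x < 1 -> P x) -> at_left 1 P.
Proof.
intros h p; assert (q : 0 < 1 - r) by lra; exists (mkposreal _ q); intros x hx h1.
apply Rabs_def2 in hx; unfold minus, plus, opp in hx; simpl in hx; apply p; lra.
Qed.

(** The hypothesis reads [(K - E)_theta = E T], so [K] is almost constant on circles close to the
    rim; on the positive axis the bound on [Kx] makes [K] Lipschitz, and [c] is its limit there.
    This replaces differentiation along the unit circle itself. *)
Lemma constant_at_rim K Kx Ky E Ex Ey T :
  has_grad K Kx Ky -> has_grad E Ex Ey ->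
  bounded_on_disk Kx -> bounded_on_disk T -> vanishes_at_rim E ->
  (forall x y, x ^ 2 + y ^ 2 < 1 ->
     x * Ky x y - y * Kx x y = x * Ey x y - y * Ex x y + E x y * T x y) ->
  exists c, vanishes_at_rim (fun x y => K x y - c).
Proof.
intros cK cE [M hM] [N hN] v e.
assert (hM0 : 0 <= M) by (apply Rle_trans with (2 := hM 0 0 ltac:(lra)); apply Rabs_pos).
assert (hN0 : 0 <= N) by (apply Rle_trans with (2 := hN 0 0 ltac:(lra)); apply Rabs_pos).
assert (lip : forall a b, 0 <= a < 1 -> 0 <= b < 1 ->
  Rabs (K a 0 - K b 0) <= M * Rabs (a - b)).
{ intros a b ha hb.
  assert (q : forall t, Rmin b a <= t <= Rmax b a -> 0 <= t < 1).
  { intros t; unfold Rmin, Rmax; destruct (Rle_dec b a); lra. }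
  destruct (MVT_gen (fun t => K t 0) b a (fun t => Kx t 0)) as [t [ht et]].
  - intros t ht; apply cK; specialize (q t ltac:(lra)); nra.
  - intros t ht; apply continuity_pt_filterlim, (continuous_2d_fst K), cK.
    specialize (q t ltac:(lra)); nra.
  - rewrite et, Rabs_mult; apply Rmult_le_compat_r; [apply Rabs_pos|].
    apply hM; specialize (q t ht); nra. }
destruct (proj1 (filterlim_locally_cauchy (F := at_left 1) (U := R_CompleteSpace)
  (fun x => K x 0))) as [c hc].
{ intros eps; set (d := eps / (M + 1)).
  assert (hd : 0 < d) by (apply Rdiv_lt_0_compat; [apply cond_pos | lra]).
  exists (fun x => Rmax 0 (1 - d) < x < 1); split.
  - apply (at_left_near (Rmax 0 (1 - d))); [apply Rmax_lub_lt; lra | trivial].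
  - intros a b ha hb; assert (q1 := Rmax_l 0 (1 - d)); assert (q2 := Rmax_r 0 (1 - d)).
    change (Rabs (K b 0 - K a 0) < eps).
    apply Rle_lt_trans with (1 := lip b a ltac:(lra) ltac:(lra)).
    assert (Rabs (b - a) < d) by (apply Rabs_def1; lra).
    assert (eq : eps = d * (M + 1) :> R) by (unfold d; field; lra).
    rewrite eq; generalize (Rabs_pos (b - a)); nra. }
exists c; intros eps he.
assert (hpi : PI <= 4) by apply PI_4.
assert (hpi0 := PI_RGT_0).
(* Error budget: [E] at the two ends of the arc costs [2 * e1], the variation of [K - E] costs
   [4 * N * e1] because angles are at most [PI <= 4], and the limit on the axis costs [eps / 2]. *)
set (e1 := eps / (2 * (3 + 4 * N))).
assert (he1 : 0 < e1) by (apply Rdiv_lt_0_compat; lra).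
assert (ee : e1 * (3 + 4 * N) = eps / 2) by (unfold e1; field; lra).
destruct (v e1 he1) as [r [hr hv]].
assert (he2 : 0 < eps / 2) by lra.
destruct (proj1 (filterlim_locally _ c) hc (mkposreal _ he2)) as [d hd].
set (s := Rmax 0 (1 - d)).
assert (hs : 0 <= s < 1).
{ split; [apply Rmax_l | apply Rmax_lub_lt; generalize (cond_pos d); lra]. }
exists (Rmax r (s ^ 2)); split.
{ split; [apply Rle_trans with r; [lra | apply Rmax_l] | apply Rmax_lub_lt; nra]. }
intros x y h.
assert (q1 := Rmax_l r (s ^ 2)); assert (q2 := Rmax_r r (s ^ 2)).
destruct (polar x y) as (p & t & hp & ht & ex & ey).
assert (n := polar_norm p t); rewrite <- ex, <- ey in n.
assert (hp1 : s < p < 1) by nra.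
assert (near : Rabs (K p 0 - c) < eps / 2).
{ apply hd; [|lra]; apply Rabs_def1; unfold minus, plus, opp; simpl;
  generalize (Rmax_r 0 (1 - d)); fold s; lra. }
assert (pn : forall t, r < (p * cos t) ^ 2 + (p * sin t) ^ 2 < 1).
{ intros; rewrite polar_norm; lra. }
set (g := fun t => K (p * cos t) (p * sin t) - E (p * cos t) (p * sin t)).
set (dg := fun t => E (p * cos t) (p * sin t) * T (p * cos t) (p * sin t)).
assert (hg : forall t, is_derive g t (dg t)).
{ intros a; evar_last.
  - apply (is_derive_minus (fun t => K (p * cos t) (p * sin t))
      (fun t => E (p * cos t) (p * sin t))).
    + apply (grad_comp K Kx Ky (fun t => p * cos t) (fun t => p * sin t) a); trivial;
        [apply pn | auto_derive; trivial | auto_derive; trivial].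
    + apply (grad_comp E Ex Ey (fun t => p * cos t) (fun t => p * sin t) a); trivial;
        [apply pn | auto_derive; trivial | auto_derive; trivial].
  - specialize (e (p * cos a) (p * sin a) ltac:(apply pn)).
    unfold dg, minus, plus, opp; simpl; lra. }
assert (step : Rabs (g t - g 0) <= e1 * N * 4).
{ destruct (MVT_gen g 0 t dg) as [a [_ ha]].
  - intros; apply hg.
  - intros; apply continuity_pt_filterlim, (ex_derive_continuous g); eexists; apply hg.
  - rewrite ha, Rabs_mult; apply Rmult_le_compat; try apply Rabs_pos.
    + unfold dg; rewrite Rabs_mult; apply Rmult_le_compat; try apply Rabs_pos.
      * apply Rlt_le, hv, pn.
      * apply hN, pn.
    + rewrite Rminus_0_r; apply Rabs_le; lra. }
assert (v1 := hv (p * cos t) (p * sin t) (pn t)).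
assert (v2 := hv (p * cos 0) (p * sin 0) (pn 0)).
assert (z : p * cos 0 = p /\ p * sin 0 = 0) by (rewrite cos_0, sin_0; split; ring).
unfold g in step; rewrite (proj1 z), (proj2 z) in step, v2; rewrite <- ex, <- ey in step, v1.
apply Rabs_def2 in v1; apply Rabs_def2 in v2; apply Rabs_def2 in near.
apply Rabs_le_between in step; apply Rabs_def1; nra.
Qed.

Lemma grad_eq F Fx Fy Gx Gy :
  has_grad F Fx Fy ->
  (forall x y, x ^ 2 + y ^ 2 < 1 -> Fx x y = Gx x y /\ Fy x y = Gy x y) ->
  has_grad F Gx Gy.
Proof. intros c e; apply grad_ext with (1 := c); intros x y h; split; auto. Qed.

(** * The Hopf differential *)

(* [J m k] stands for the partial derivative [d^(m+k) u / dx^m dy^k]. *)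
Definition jet (J : nat -> nat -> R -> R -> R) : Prop :=
  forall m k, has_grad (J m k) (J (S m) k) (J m (S k)).

(** All that the argument retains of a solution. Smoothness up to the boundary survives as
    boundedness of every derivative, and the boundary condition as a uniform limit involving
    [r u_r]. *)
Definition interior_solution (lambda : R) (J : nat -> nat -> R -> R -> R) : Prop :=
  jet J /\ (forall m k, bounded_on_disk (J m k)) /\
  (forall x y, x ^ 2 + y ^ 2 < 1 -> J 2%nat 0%nat x y + J 0%nat 2%nat x y = - exp (2 * J 0%nat 0%nat x y)) /\
  vanishes_at_rim (fun x y =>
    x * J 1%nat 0%nat x y + y * J 0%nat 1%nat x y + lambda - exp (J 0%nat 0%nat x y)).

(* [4 phi = hopf_re + i hopf_im]; the primed functions are its complex derivative. *)
Definition hopf_re (J : nat -> nat -> R -> R -> R) (x y : R) : R :=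
  J 2%nat 0%nat x y - J 0%nat 2%nat x y - J 1%nat 0%nat x y * J 1%nat 0%nat x y
  + J 0%nat 1%nat x y * J 0%nat 1%nat x y.

Definition hopf_im (J : nat -> nat -> R -> R -> R) (x y : R) : R :=
  2 * (J 1%nat 0%nat x y * J 0%nat 1%nat x y) - 2 * J 1%nat 1%nat x y.

Definition hopf_re' (J : nat -> nat -> R -> R -> R) (x y : R) : R :=
  J 3%nat 0%nat x y - J 1%nat 2%nat x y - 2 * (J 1%nat 0%nat x y * J 2%nat 0%nat x y)
  + 2 * (J 0%nat 1%nat x y * J 1%nat 1%nat x y).

Definition hopf_im' (J : nat -> nat -> R -> R -> R) (x y : R) : R :=
  2 * (J 2%nat 0%nat x y * J 0%nat 1%nat x y + J 1%nat 0%nat x y * J 1%nat 1%nat x y)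
  - 2 * J 2%nat 1%nat x y.

(** Syntax-directed differentiation: the partial derivatives may be left to unification, after which
    [grad_eq] and [ring] bring them to the desired form. *)
Ltac grad :=
  lazymatch goal with
  | |- has_grad (fun x y => @?F x y + @?G x y) _ _ => eapply (grad_plus F _ _ G); grad
  | |- has_grad (fun x y => @?F x y - @?G x y) _ _ => eapply (grad_minus F _ _ G); grad
  | |- has_grad (fun x y => @?F x y * @?G x y) _ _ => eapply (grad_mult F _ _ G); grad
  | |- has_grad (fun x y => - @?F x y) _ _ => eapply (grad_opp F); grad
  | |- has_grad (fun x y => exp (@?F x y)) _ _ => eapply (grad_exp F); grad
  | |- has_grad (fun x _ => x) _ _ => apply grad_fst
  | |- has_grad (fun _ y => y) _ _ => apply grad_snd
  | |- has_grad (fun _ _ => ?c) _ _ => apply grad_const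
  | h : jet ?J |- has_grad (fun x y => ?J _ _ x y) _ _ => apply h
  | |- _ => eassumption
  end.

Ltac bounded :=
  lazymatch goal with
  | |- bounded_on_disk (fun x y => @?F x y + @?G x y) => apply (bounded_plus F G); bounded
  | |- bounded_on_disk (fun x y => @?F x y - @?G x y) => apply (bounded_minus F G); bounded
  | |- bounded_on_disk (fun x y => @?F x y * @?G x y) => apply (bounded_mult F G); bounded
  | |- bounded_on_disk (fun x y => - @?F x y) => apply (bounded_opp F); bounded
  | |- bounded_on_disk (fun x y => exp (@?F x y)) => apply (bounded_exp F); bounded
  | |- bounded_on_disk (fun x _ => x) => apply bounded_fst
  | |- bounded_on_disk (fun _ y => y) => apply bounded_snd
  | |- bounded_on_disk (fun _ _ => ?c) => apply bounded_const
  | h : forall m k, bounded_on_disk (?J m k) |- bounded_on_disk (fun x y => ?J _ _ x y) => apply h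
  | |- _ => assumption
  end.

(** phi_zbar = (u_zzbar)_z - 2 u_z u_zzbar, which is 0 because u_zzbar = - e^(2u) / 4. *)
Lemma hopf_holomorphic lambda J :
  interior_solution lambda J ->
  has_grad (hopf_re J) (hopf_re' J) (fun x y => - hopf_im' J x y) /\
  has_grad (hopf_im J) (hopf_im' J) (hopf_re' J).
Proof.
intros (hj & _ & pde & _).
(* Two gradients of the Laplacian of [u], one from the jet and one ([g2]) from the equation. Their
   equality expresses [J 3 0] and [J 0 3] through the mixed third derivatives. *)
assert (g1 : has_grad (fun x y => J 2%nat 0%nat x y + J 0%nat 2%nat x y)
  (fun x y => J 3%nat 0%nat x y + J 1%nat 2%nat x y)
  (fun x y => J 2%nat 1%nat x y + J 0%nat 3%nat x y)) by grad.
assert (g2 : has_grad (fun x y => J 2%nat 0%nat x y + J 0%nat 2%nat x y)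
  (fun x y => - 2 * J 1%nat 0%nat x y * exp (2 * J 0%nat 0%nat x y))
  (fun x y => - 2 * J 0%nat 1%nat x y * exp (2 * J 0%nat 0%nat x y))).
{ eapply grad_ext.
  - eapply (grad_opp (fun x y => exp (2 * J 0%nat 0%nat x y))); grad.
  - intros x y h; cbv beta; rewrite (pde x y h); repeat split; ring. }
split.
- eapply grad_eq; [unfold hopf_re; grad|]; intros x y h; cbv beta.
  destruct (grad_unique _ _ _ _ _ x y g1 g2 h) as [e1 e2]; specialize (pde x y h).
  unfold hopf_re, hopf_re', hopf_im'; repeat split; try ring.
  replace (J 0%nat 3%nat x y) with (- J 2%nat 1%nat x y - 2 * J 0%nat 1%nat x y * exp (2 * J 0%nat 0%nat x y)) by lra.
  replace (J 0%nat 2%nat x y) with (- J 2%nat 0%nat x y - exp (2 * J 0%nat 0%nat x y)) by lra.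
  ring.
- eapply grad_eq; [unfold hopf_im; grad|]; intros x y h; cbv beta.
  destruct (grad_unique _ _ _ _ _ x y g1 g2 h) as [e1 e2]; specialize (pde x y h).
  unfold hopf_im, hopf_re', hopf_im'; repeat split; try ring.
  replace (J 3%nat 0%nat x y) with (- J 1%nat 2%nat x y - 2 * J 1%nat 0%nat x y * exp (2 * J 0%nat 0%nat x y)) by lra.
  replace (J 0%nat 2%nat x y) with (- J 2%nat 0%nat x y - exp (2 * J 0%nat 0%nat x y)) by lra.
  ring.
Qed.

(* The gradient of the harmonic function [h] with [h_z = - z phi / mu]. *)
Definition dual_x mu J (x y : R) := - / (2 * mu) * (x * hopf_re J x y - y * hopf_im J x y).
Definition dual_y mu J (x y : R) := / (2 * mu) * (x * hopf_im J x y + y * hopf_re J x y).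

(** Since z phi is holomorphic, the Cauchy-Riemann equations make the field closed, as [poincare]
    requires, and divergence free, so that its potential is harmonic. *)
Lemma grad_dual lambda mu J :
  interior_solution lambda J ->
  has_grad (dual_x mu J)
    (fun x y => - / (2 * mu) * (hopf_re J x y + x * hopf_re' J x y - y * hopf_im' J x y))
    (fun x y => / (2 * mu) * (hopf_im J x y + x * hopf_im' J x y + y * hopf_re' J x y)) /\
  has_grad (dual_y mu J)
    (fun x y => / (2 * mu) * (hopf_im J x y + x * hopf_im' J x y + y * hopf_re' J x y))
    (fun x y => / (2 * mu) * (hopf_re J x y + x * hopf_re' J x y - y * hopf_im' J x y)).
Proof.
intros hs; destruct (hopf_holomorphic lambda J hs) as [ga gb].
split; (eapply grad_eq; [unfold dual_x, dual_y; grad|]);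
  intros x y h; cbv beta; unfold dual_x, dual_y; repeat split; ring.
Qed.

Lemma bounded_hopf lambda J :
  interior_solution lambda J ->
  bounded_on_disk (hopf_re J) /\ bounded_on_disk (hopf_im J) /\
  bounded_on_disk (hopf_re' J) /\ bounded_on_disk (hopf_im' J).
Proof.
intros (_ & hb & _); unfold hopf_re, hopf_im, hopf_re', hopf_im'; repeat split; bounded.
Qed.

(* With [E = r u_r + lambda - e^u], which tends to [0] at the rim, the identity
   [mu (u - h)_theta = E_theta - E u_theta] makes [u - h] constant there. *)
Lemma harmonic_extension lambda J :
  lambda <> 1 -> interior_solution lambda J ->
  exists H, has_grad H (dual_x (1 - lambda) J) (dual_y (1 - lambda) J) /\
    vanishes_at_rim (fun x y => J 0%nat 0%nat x y - H x y).
Proof.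
intros hl hs; assert (hmu : 1 - lambda <> 0) by lra.
destruct (grad_dual lambda (1 - lambda) J hs) as [gx gy].
destruct (bounded_hopf lambda J hs) as (ba & bb & _).
destruct (poincare _ _ _ _ _ _ gx gy) as [H0 hH0]; [trivial|].
set (mu := 1 - lambda) in *.
assert (hs' := hs); destruct hs' as (hj & hb & pde & v).
assert (gE : has_grad (fun x y =>
    / mu * (x * J 1%nat 0%nat x y + y * J 0%nat 1%nat x y + lambda - exp (J 0%nat 0%nat x y)))
  (fun x y => / mu * (J 1%nat 0%nat x y + x * J 2%nat 0%nat x y + y * J 1%nat 1%nat x y
    - J 1%nat 0%nat x y * exp (J 0%nat 0%nat x y)))
  (fun x y => / mu * (J 0%nat 1%nat x y + x * J 1%nat 1%nat x y + y * J 0%nat 2%nat x y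
    - J 0%nat 1%nat x y * exp (J 0%nat 0%nat x y)))).
{ eapply grad_eq; [grad|]; intros x y h; cbv beta; repeat split; ring. }
assert (gK : has_grad (fun x y => J 0%nat 0%nat x y - H0 x y)
  (fun x y => J 1%nat 0%nat x y - dual_x mu J x y)
  (fun x y => J 0%nat 1%nat x y - dual_y mu J x y)) by grad.
destruct (constant_at_rim _ _ _ _ _ _
  (fun x y => - (x * J 0%nat 1%nat x y - y * J 1%nat 0%nat x y)) gK gE) as [c hc].
- unfold dual_x; bounded.
- bounded.
- apply (vanishes_ext _ _ (fun x y _ => Rmult_comm _ _)), vanishes_mult; trivial.
  apply bounded_const.
- intros x y h; unfold dual_x, dual_y, hopf_re, hopf_im.
  replace lambda with (1 - mu) by (unfold mu; ring); field; exact hmu.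
- exists (fun x y => H0 x y + c); split.
  + eapply grad_ext; [apply (grad_plus _ _ _ _ _ _ hH0 (grad_const c))|].
    intros x y _; cbv beta; repeat split; ring.
  + apply (vanishes_ext _ _) with (2 := hc); intros; ring.
Qed.

(** * Vanishing of the Hopf differential *)

(** The flux argument is silent at the centre, where the factor [r] in the derivative of the flux
    vanishes; continuity fills the gap. *)
Lemma zero_at_origin (f : R -> R -> R) :
  continuity_2d_pt f 0 0 ->
  (forall x y, x ^ 2 + y ^ 2 < 1 -> x <> 0 \/ y <> 0 -> f x y = 0) ->
  forall x y, x ^ 2 + y ^ 2 < 1 -> f x y = 0.
Proof.
intros c z x y h.
destruct (Req_dec x 0) as [ex|ex]; [|auto].
destruct (Req_dec y 0) as [ey|ey]; [|auto].
subst; destruct (Req_dec (f 0 0) 0) as [e|e]; [exact e|exfalso].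
destruct (continuity_2d_pt_neq_0 f 0 0 c e) as [d hd].
set (k := Rmin d 1 / 2).
assert (hk : 0 < k /\ k < d /\ k < 1).
{ assert (p := Rmin_pos d 1 (cond_pos d) Rlt_0_1); assert (q := Rmin_l d 1).
  assert (q' := Rmin_r d 1); unfold k; lra. }
apply (hd k 0).
- rewrite Rminus_0_r, Rabs_right; lra.
- rewrite Rminus_0_r, Rabs_R0; apply cond_pos.
- apply z; [nra | left; lra].
Qed.

(** As [H] is harmonic, the Laplacian of [u - H] is - e^(2u) < 0. *)
Lemma superharmonic_above lambda J H :
  interior_solution lambda J ->
  has_grad H (dual_x (1 - lambda) J) (dual_y (1 - lambda) J) ->
  vanishes_at_rim (fun x y => J 0%nat 0%nat x y - H x y) ->
  forall x y, x ^ 2 + y ^ 2 < 1 -> H x y <= J 0%nat 0%nat x y.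
Proof.
intros hs hH v x y h.
destruct (grad_dual lambda (1 - lambda) J hs) as [gx gy].
destruct hs as (hj & _ & pde & _).
apply Rge_le, Rminus_ge, Rle_ge.
apply (superharmonic_nonneg (fun x y => J 0%nat 0%nat x y - H x y) _ _ _ _ _ _
  (grad_minus _ _ _ _ _ _ (hj 0%nat 0%nat) hH) (grad_minus _ _ _ _ _ _ (hj 1%nat 0%nat) gx)
  (grad_minus _ _ _ _ _ _ (hj 0%nat 1%nat) gy)); trivial.
clear x y h; intros x y h; specialize (pde x y h).
assert (p := exp_pos (2 * J 0%nat 0%nat x y)); cbv beta.
apply Rle_lt_trans with (J 2%nat 0%nat x y + J 0%nat 2%nat x y); [apply Req_le; ring | lra].
Qed.

Definition hopf_norm2 J (x y : R) := hopf_re J x y * hopf_re J x y + hopf_im J x y * hopf_im J x y.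

(** In complex form V - i W = 4 phi (X + i Y), so holomorphy of phi reduces the divergence to 8 Re
    (phi d/dzbar (X + i Y)). The factor [/ 2] appears because [hopf_norm2] is |4 phi|^2. *)
Lemma pohozaev_field lambda J H :
  lambda <> 1 -> interior_solution lambda J ->
  has_grad H (dual_x (1 - lambda) J) (dual_y (1 - lambda) J) ->
  vanishes_at_rim (fun x y => J 0%nat 0%nat x y - H x y) ->
  exists V Vx Vy W Wx Wy, has_grad V Vx Vy /\ has_grad W Wx Wy /\
    vanishes_at_rim (fun x y => x * V x y + y * W x y) /\
    forall x y, x ^ 2 + y ^ 2 < 1 -> Vx x y + Wy x y =
      / 2 * hopf_norm2 J x y * ((x ^ 2 + y ^ 2) / (1 - lambda) * exp (- H x y)
        + (1 - (x ^ 2 + y ^ 2)) * exp (- J 0%nat 0%nat x y)).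
Proof.
intros hl hs hH v; assert (hmu : 1 - lambda <> 0) by lra.
destruct (hopf_holomorphic lambda J hs) as [ga gb].
destruct (bounded_hopf lambda J hs) as (ba & bb & _).
destruct hs as (hj & hb & pde & _).
set (mu := 1 - lambda) in *.
(* X + i Y = z e^(-h) - ((1 - r^2) f_zbar + z f); it tends to 0 at the rim because e^(-h) and f
   agree there. *)
set (X := fun x y => x * (exp (- H x y) - exp (- J 0%nat 0%nat x y))
  + / 2 * J 1%nat 0%nat x y * ((1 - (x * x + y * y)) * exp (- J 0%nat 0%nat x y))).
set (Y := fun x y => y * (exp (- H x y) - exp (- J 0%nat 0%nat x y))
  + / 2 * J 0%nat 1%nat x y * ((1 - (x * x + y * y)) * exp (- J 0%nat 0%nat x y))).
assert (vw : vanishes_at_rim (fun x y => exp (- H x y) - exp (- J 0%nat 0%nat x y))).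
{ apply (vanishes_ext (fun x y => (exp (J 0%nat 0%nat x y - H x y) - 1) * exp (- J 0%nat 0%nat x y))).
  - intros x y _; rewrite Rmult_minus_distr_r, <- exp_plus, Rmult_1_l; f_equal; f_equal; ring.
  - apply vanishes_mult; [now apply (vanishes_exp (fun x y => J 0%nat 0%nat x y - H x y)) | bounded]. }
assert (vm : vanishes_at_rim (fun x y => (1 - (x ^ 2 + y ^ 2)) * exp (- J 0%nat 0%nat x y))).
{ apply vanishes_mult; [apply vanishes_rim | bounded]. }
eexists (fun x y => hopf_re J x y * X x y - hopf_im J x y * Y x y), _, _,
  (fun x y => - (hopf_re J x y * Y x y + hopf_im J x y * X x y)), _, _.
split; [unfold X, Y; grad|split; [unfold X, Y; grad|split]].
- apply (vanishes_ext (fun x y =>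
    (exp (- H x y) - exp (- J 0%nat 0%nat x y)) *
      (x * (hopf_re J x y * x - hopf_im J x y * y) - y * (hopf_re J x y * y + hopf_im J x y * x))
    + (1 - (x ^ 2 + y ^ 2)) * exp (- J 0%nat 0%nat x y) *
      (/ 2 * (x * (hopf_re J x y * J 1%nat 0%nat x y - hopf_im J x y * J 0%nat 1%nat x y)
         - y * (hopf_re J x y * J 0%nat 1%nat x y + hopf_im J x y * J 1%nat 0%nat x y))))).
  + intros; unfold X, Y; ring.
  + apply vanishes_plus; apply vanishes_mult; trivial; bounded.
- intros x y h; cbv beta; unfold X, Y, dual_x, dual_y, hopf_norm2.
  (* With u_xy and u_xx expressed through the components of phi, the divergence formula becomes a
     rational identity. *)
  assert (e : J 1%nat 1%nat x y = J 1%nat 0%nat x y * J 0%nat 1%nat x y - hopf_im J x y / 2).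
  { unfold hopf_im; field. }
  assert (e' : J 2%nat 0%nat x y = hopf_re J x y + J 0%nat 2%nat x y
    + J 1%nat 0%nat x y * J 1%nat 0%nat x y - J 0%nat 1%nat x y * J 0%nat 1%nat x y).
  { unfold hopf_re; ring. }
  rewrite e, e'; field; exact hmu.
Qed.

(** This is the field of Green's second identity, - 1/8 (m^2 grad N - N grad m^2) with m = 1 - r^2
    and N = |4 phi|^2 e^(-u). The Laplacian of m^2 is - 8 (1 - 2 r^2), and m^2 vanishes on the
    circle together with its gradient, so boundedness of N and grad N controls the flux. *)
Lemma weight_field lambda J :
  interior_solution lambda J ->
  exists V Vx Vy W Wx Wy, has_grad V Vx Vy /\ has_grad W Wx Wy /\
    vanishes_at_rim (fun x y => x * V x y + y * W x y) /\
    forall x y, x ^ 2 + y ^ 2 < 1 ->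
      Vx x y + Wy x y + hopf_norm2 J x y * exp (- J 0%nat 0%nat x y) * (1 - 2 * (x ^ 2 + y ^ 2))
      <= - / 8 * (1 - (x ^ 2 + y ^ 2)) ^ 2 * (hopf_norm2 J x y * exp (J 0%nat 0%nat x y)).
Proof.
intros hs.
destruct (hopf_holomorphic lambda J hs) as [ga gb].
destruct (bounded_hopf lambda J hs) as (ba & bb & ba' & bb').
destruct hs as (hj & hb & pde & _).
assert (ga' : exists a b, has_grad (hopf_re' J) a b) by (eexists _, _; unfold hopf_re'; grad).
assert (gb' : exists a b, has_grad (hopf_im' J) a b) by (eexists _, _; unfold hopf_im'; grad).
destruct ga' as (a1 & a2 & ga'); destruct gb' as (b1 & b2 & gb').
set (N := fun x y => (hopf_re J x y * hopf_re J x y + hopf_im J x y * hopf_im J x y)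
  * exp (- J 0%nat 0%nat x y)).
set (Nx := fun x y => 2 * (hopf_re J x y * hopf_re' J x y + hopf_im J x y * hopf_im' J x y)
  * exp (- J 0%nat 0%nat x y) - J 1%nat 0%nat x y *
  ((hopf_re J x y * hopf_re J x y + hopf_im J x y * hopf_im J x y) * exp (- J 0%nat 0%nat x y))).
set (Ny := fun x y => 2 * (hopf_im J x y * hopf_re' J x y - hopf_re J x y * hopf_im' J x y)
  * exp (- J 0%nat 0%nat x y) - J 0%nat 1%nat x y *
  ((hopf_re J x y * hopf_re J x y + hopf_im J x y * hopf_im J x y) * exp (- J 0%nat 0%nat x y))).
set (m := fun x y : R => 1 - (x * x + y * y)).
eexists (fun x y => - / 8 * (m x y * m x y) * Nx x y - N x y * (/ 2 * m x y * x)), _, _,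
  (fun x y => - / 8 * (m x y * m x y) * Ny x y - N x y * (/ 2 * m x y * y)), _, _.
split; [unfold N, Nx, m; grad|split; [unfold N, Ny, m; grad|split]].
- apply (vanishes_ext (fun x y => (1 - (x ^ 2 + y ^ 2)) *
    (x * (- / 8 * (1 - (x * x + y * y)) * Nx x y - N x y * (/ 2 * x))
     + y * (- / 8 * (1 - (x * x + y * y)) * Ny x y - N x y * (/ 2 * y))))).
  + intros; unfold m; ring.
  + apply vanishes_mult; [apply vanishes_rim | unfold N, Nx, Ny; bounded].
- intros x y h; cbv beta; unfold Nx, Ny, N, m, hopf_norm2.
  (* Symmetry of the second derivatives of phi gives the Cauchy-Riemann equations for phi'. Through
     them the second derivatives, known only to exist, cancel from the Laplacian of [N]. *)
  assert (c1 := grad_schwarz _ _ _ _ _ _ _ x y ga ga' (grad_opp _ _ _ gb') h).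
  assert (c2 := grad_schwarz _ _ _ _ _ _ _ x y gb gb' ga' h).
  cbv beta in c1, c2.
  specialize (pde x y h).
  assert (e0 : exp (J 0%nat 0%nat x y) = exp (2 * J 0%nat 0%nat x y) * exp (- J 0%nat 0%nat x y)).
  { rewrite <- exp_plus; f_equal; ring. }
  assert (p := exp_pos (- J 0%nat 0%nat x y)).
  assert (e20 : J 2%nat 0%nat x y = - exp (2 * J 0%nat 0%nat x y) - J 0%nat 2%nat x y) by lra.
  rewrite e0, e20, c1, c2.
  set (al := hopf_re J x y); set (be := hopf_im J x y); set (al' := hopf_re' J x y).
  set (be' := hopf_im' J x y); set (p1 := J 1%nat 0%nat x y); set (q1 := J 0%nat 1%nat x y).
  set (E := exp (- J 0%nat 0%nat x y)) in *.
  (* [Lap N = 4 e^(-u) |phi' - u_z phi|^2 + N e^(2u)] for [N = |phi|^2 e^(-u)] *)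
  assert (sq : 0 <= (1 - (x * x + y * y)) ^ 2 * (E *
    ((al' - (al * p1 + be * q1) / 2) ^ 2 + (be' - (be * p1 - al * q1) / 2) ^ 2))).
  { apply Rmult_le_pos; [apply pow2_ge_0|]; apply Rmult_le_pos; [lra|].
    apply Rplus_le_le_0_compat; apply pow2_ge_0. }
  apply Rminus_le.
  match goal with |- ?e <= 0 => replace e with (- / 2 * ((1 - (x * x + y * y)) ^ 2 * (E *
    ((al' - (al * p1 + be * q1) / 2) ^ 2 + (be' - (be * p1 - al * q1) / 2) ^ 2)))) end.
  + lra.
  + field.
Qed.

(* The heart of the matter: for [lambda < 1] both terms in the divergence of the Pohozaev
   field are nonnegative; for [1 < lambda <= 2], [H <= u] bounds that divergence by
   [|phi|^2 e^(-u) (1 - 2 r^2) / 2], which the field of [weight_field] compensates. *)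
Lemma hopf_vanishes lambda J :
  lambda <= 2 -> lambda <> 1 -> interior_solution lambda J ->
  forall x y, x ^ 2 + y ^ 2 < 1 -> hopf_norm2 J x y = 0.
Proof.
intros hl2 hl hs.
destruct (harmonic_extension lambda J hl hs) as (H & hH & vH).
destruct (pohozaev_field lambda J H hl hs hH vH) as (V & Vx & Vy & W & Wx & Wy & gV & gW & vV & dV).
assert (n0 : forall x y, 0 <= hopf_norm2 J x y) by (intros; unfold hopf_norm2; nra).
apply zero_at_origin.
{ destruct (hopf_holomorphic lambda J hs) as [ga gb].
  assert (h0 : 0 ^ 2 + 0 ^ 2 < 1) by lra.
  apply continuity_2d_pt_plus; apply continuity_2d_pt_mult;
    first [apply (ga 0 0 h0) | apply (gb 0 0 h0)]. }
destruct (Rlt_le_dec lambda 1) as [hlt|hge].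
- assert (pos : forall x y, x ^ 2 + y ^ 2 < 1 ->
    0 <= (x ^ 2 + y ^ 2) / (1 - lambda) * exp (- H x y) /\
    0 < (1 - (x ^ 2 + y ^ 2)) * exp (- J 0%nat 0%nat x y)).
  { intros x y h; split.
    - apply Rmult_le_pos; [|apply Rlt_le, exp_pos].
      apply Rdiv_le_0_compat; [nra | lra].
    - apply Rmult_lt_0_compat; [lra | apply exp_pos]. }
  intros x y h nz.
  assert (z := divergence_zero V Vx Vy W Wx Wy gV gW).
  specialize (z ltac:(intros a b hab; rewrite dV by exact hab; specialize (n0 a b);
    destruct (pos a b hab); apply Rmult_le_pos; lra) vV x y h nz).
  rewrite dV in z by exact h; destruct (pos x y h); specialize (n0 x y); nra.
- destruct (weight_field lambda J hs) as (V' & V'x & V'y & W' & W'x & W'y & gV' & gW' & vV' & dV').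
  set (nu := lambda - 1); assert (hnu : 0 < nu <= 1) by (unfold nu; lra).
  (* Half of the weight field is what cancels the remainder, which carries the factor [/ 2]; the
     constant [/ 16] is half of its [/ 8]. *)
  assert (key : forall x y, x ^ 2 + y ^ 2 < 1 ->
    / 16 * (1 - (x ^ 2 + y ^ 2)) ^ 2 * (hopf_norm2 J x y * exp (J 0%nat 0%nat x y)) <=
    - (Vx x y + / 2 * V'x x y) + - (Wy x y + / 2 * W'y x y)).
  { intros x y h; specialize (dV x y h); specialize (dV' x y h).
    assert (hle := superharmonic_above lambda J H hs hH vH x y h).
    assert (ee : exp (- J 0%nat 0%nat x y) <= exp (- H x y)).
    { destruct (Rle_lt_or_eq_dec _ _ hle) as [q|q];
        [apply Rlt_le, exp_increasing; lra | rewrite q; lra]. }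
    assert (p := exp_pos (- J 0%nat 0%nat x y)).
    assert (r0 : 0 <= x ^ 2 + y ^ 2) by nra.
    (* Here [lambda <= 2] enters, as [nu <= 1]: together with [H <= u] it gives e^(-H) / nu >=
       e^(-u). *)
    assert (inu : 1 <= / nu) by (rewrite <- Rinv_1; apply Rinv_le_contravar; lra).
    replace ((x ^ 2 + y ^ 2) / (1 - lambda)) with (- ((x ^ 2 + y ^ 2) * / nu)) in dV
      by (unfold nu; field; lra).
    assert (a1 : exp (- J 0%nat 0%nat x y) <= / nu * exp (- H x y)) by nra.
    assert (a2 := Rmult_le_compat_l _ _ _ (Rmult_le_pos _ _ (n0 x y) r0) a1).
    lra. }
  intros x y h nz.
  assert (z := divergence_zero _ _ _ _ _ _
    (grad_opp _ _ _ (grad_plus _ _ _ _ _ _ gV (grad_mult _ _ _ _ _ _ (grad_const (/ 2)) gV')))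
    (grad_opp _ _ _ (grad_plus _ _ _ _ _ _ gW (grad_mult _ _ _ _ _ _ (grad_const (/ 2)) gW')))).
  assert (key' : forall x y, x ^ 2 + y ^ 2 < 1 ->
    0 <= / 16 * (1 - (x ^ 2 + y ^ 2)) ^ 2 * (hopf_norm2 J x y * exp (J 0%nat 0%nat x y))).
  { intros a b hab; apply Rmult_le_pos; [generalize (pow2_ge_0 (1 - (a ^ 2 + b ^ 2))); lra|].
    apply Rmult_le_pos; [apply n0 | apply Rlt_le, exp_pos]. }
  cbv beta in z.
  specialize (z ltac:(intros a b hab; specialize (key a b hab); specialize (key' a b hab); lra)).
  assert (vs : vanishes_at_rim (fun x y => x * - (V x y + / 2 * V' x y) + y * - (W x y + / 2 * W' x y))).
  { apply (vanishes_ext (fun x y => (x * V x y + y * W x y) * (- 1)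
      + (x * V' x y + y * W' x y) * (- / 2))); [intros; ring|].
    apply vanishes_plus; apply vanishes_mult; trivial; apply bounded_const. }
  specialize (z vs x y h nz); specialize (key x y h); specialize (n0 x y).
  assert (m : 0 < / 16 * (1 - (x ^ 2 + y ^ 2)) ^ 2 * exp (J 0%nat 0%nat x y)).
  { apply Rmult_lt_0_compat; [|apply exp_pos].
    apply Rmult_lt_0_compat; [lra | apply pow_lt; lra]. }
  nra.
Qed.

(** * Radial form of the solutions *)

(** [F] tends to 0 along the radius through [(x, y)], where it coincides with [g]; continuity of [g]
    at 1 identifies the limit as [g 1]. *)
Lemma limit_at_rim F (g : R -> R) x y :
  vanishes_at_rim F -> x ^ 2 + y ^ 2 = 1 ->
  (forall t, 0 <= t < 1 -> F (t * x) (t * y) = g t) -> continuity_pt g 1 -> g 1 = 0.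
Proof.
intros v h e c; apply cond_eq; intros eps he; rewrite Rminus_0_r.
assert (he2 : 0 < eps / 2) by lra.
destruct (v (eps / 2) he2) as [r [hr hv]].
destruct (proj1 (continuity_pt_locally g 1) c (mkposreal _ he2)) as [d hd].
set (s := Rmax r (1 - d)).
assert (hs : 0 <= s < 1).
{ split; [apply Rle_trans with r; [lra | apply Rmax_l]|].
  apply Rmax_lub_lt; generalize (cond_pos d); lra. }
assert (q1 := Rmax_l r (1 - d)); assert (q2 := Rmax_r r (1 - d)); fold s in q1, q2.
set (t := sqrt ((1 + s) / 2)).
assert (ht : t ^ 2 = (1 + s) / 2) by (apply pow2_sqrt; lra).
assert (ht0 : 0 <= t) by apply sqrt_pos.
assert (ht1 : s < t < 1) by nra.
assert (n : (t * x) ^ 2 + (t * y) ^ 2 = t ^ 2).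
{ replace (t ^ 2) with (t ^ 2 * (x ^ 2 + y ^ 2)) by (rewrite h; ring); ring. }
specialize (hv (t * x) (t * y) ltac:(rewrite n; nra)); rewrite e in hv by lra.
assert (hg : Rabs (g t - g 1) < eps / 2).
{ apply (hd t); apply Rabs_def1; unfold minus, plus, opp; simpl; lra. }
apply Rabs_def2 in hv; apply Rabs_def2 in hg; apply Rabs_def1; lra.
Qed.

(** The vanishing of phi is used twice: it gives f_zz = 0, which makes [f] quadratic with equal pure
    second derivatives, and it makes [H] constant, so that [f] has constant boundary values and
    hence no linear part. *)
Lemma interior_solution_radial lambda J :
  lambda <= 2 -> lambda <> 1 -> interior_solution lambda J ->
  exists r, 0 < r /\ (lambda - 2) * r ^ 2 - 2 * r + lambda = 0 /\
    forall x y, x ^ 2 + y ^ 2 < 1 ->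
      J 0%nat 0%nat x y = ln (2 * r / (1 + r ^ 2 * (x ^ 2 + y ^ 2))).
Proof.
intros hl2 hl hs.
assert (n0 := hopf_vanishes lambda J hl2 hl hs).
assert (ab : forall x y, x ^ 2 + y ^ 2 < 1 -> hopf_re J x y = 0 /\ hopf_im J x y = 0).
{ intros x y h; specialize (n0 x y h); unfold hopf_norm2 in n0; split; nra. }
clear n0.
destruct (harmonic_extension lambda J hl hs) as (H & hH & vH).
assert (o : 0 ^ 2 + 0 ^ 2 < 1) by lra.
assert (Hc : forall x y, x ^ 2 + y ^ 2 < 1 -> H x y = H 0 0).
{ intros x y h; apply grad_constant; trivial; apply (grad_eq _ _ _ _ _ hH).
  intros a b hab; destruct (ab a b hab) as [e1 e2]; unfold dual_x, dual_y.
  rewrite e1, e2; split; ring. }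
destruct hs as (hj & hb & pde & v).
assert (s2 : forall x y, x ^ 2 + y ^ 2 < 1 ->
  J 1%nat 1%nat x y = J 1%nat 0%nat x y * J 0%nat 1%nat x y /\
  J 2%nat 0%nat x y = (J 1%nat 0%nat x y ^ 2 - J 0%nat 1%nat x y ^ 2 - exp (2 * J 0%nat 0%nat x y)) / 2 /\
  J 0%nat 2%nat x y = (J 0%nat 1%nat x y ^ 2 - J 1%nat 0%nat x y ^ 2 - exp (2 * J 0%nat 0%nat x y)) / 2).
{ intros x y h; destruct (ab x y h) as [e1 e2]; specialize (pde x y h).
  unfold hopf_re in e1; unfold hopf_im in e2; repeat split; lra. }
set (f := fun x y => exp (- J 0%nat 0%nat x y)).
(* Half the Laplacian of [f], simplified by the equation. Its constancy follows from f_zz = 0, and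
   its value [k] is the common value of f_xx and f_yy. *)
set (P := fun x y => / 2 * ((J 1%nat 0%nat x y * J 1%nat 0%nat x y + J 0%nat 1%nat x y * J 0%nat 1%nat x y)
  * exp (- J 0%nat 0%nat x y) + exp (J 0%nat 0%nat x y))).
assert (ee : forall x y, exp (J 0%nat 0%nat x y) = exp (2 * J 0%nat 0%nat x y) * exp (- J 0%nat 0%nat x y)).
{ intros x y; rewrite <- exp_plus; f_equal; ring. }
assert (Pc : forall x y, x ^ 2 + y ^ 2 < 1 -> P x y = P 0 0).
{ intros x y h; apply grad_constant; trivial; eapply grad_eq; [unfold P; grad|].
  intros a b hab; destruct (s2 a b hab) as (e1 & e2 & e3); cbv beta.
  rewrite ee, e1, e2, e3; split; field. }
set (k := P 0 0) in *.
assert (k0 : 0 < k).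
{ unfold k, P; assert (p1 := exp_pos (J 0%nat 0%nat 0 0)); assert (p2 := exp_pos (- J 0%nat 0%nat 0 0)).
  assert (0 <= (J 1%nat 0%nat 0 0 * J 1%nat 0%nat 0 0 + J 0%nat 1%nat 0 0 * J 0%nat 1%nat 0 0)) by nra.
  nra. }
set (fx := fun x y => - J 1%nat 0%nat x y * exp (- J 0%nat 0%nat x y)).
set (fy := fun x y => - J 0%nat 1%nat x y * exp (- J 0%nat 0%nat x y)).
assert (gf : has_grad f fx fy) by (unfold f; grad).
assert (cx : forall x y, x ^ 2 + y ^ 2 < 1 -> fx x y - k * x = fx 0 0 - k * 0).
{ intros x y h; apply (grad_constant (fun x y => fx x y - k * x)); trivial.
  eapply grad_eq; [unfold fx; grad|].
  intros a b hab; destruct (s2 a b hab) as (e1 & e2 & e3); cbv beta.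
  rewrite <- (Pc a b hab); unfold P; rewrite ee, e1, e2; split; field. }
assert (cy : forall x y, x ^ 2 + y ^ 2 < 1 -> fy x y - k * y = fy 0 0 - k * 0).
{ intros x y h; apply (grad_constant (fun x y => fy x y - k * y)); trivial.
  eapply grad_eq; [unfold fy; grad|].
  intros a b hab; destruct (s2 a b hab) as (e1 & e2 & e3); cbv beta.
  rewrite <- (Pc a b hab); unfold P; rewrite ee, e1, e3; split; field. }
set (b := fx 0 0) in *; set (c := fy 0 0) in *.
assert (cf : forall x y, x ^ 2 + y ^ 2 < 1 ->
  f x y = f 0 0 + b * x + c * y + k / 2 * (x * x + y * y)).
{ intros x y h.
  assert (e := grad_constant (fun x y => f x y - (b * x + c * y + k / 2 * (x * x + y * y))) x y).
  cbv beta in e; enough (z : f x y - (b * x + c * y + k / 2 * (x * x + y * y))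
    = f 0 0 - (b * 0 + c * 0 + k / 2 * (0 * 0 + 0 * 0))) by lra.
  apply e; trivial; clear e; eapply grad_eq; [grad|]; intros a a' ha; cbv beta.
  specialize (cx a a' ha); specialize (cy a a' ha); split; lra. }
set (a := f 0 0) in *.
assert (vf : vanishes_at_rim (fun x y => f x y - exp (- H 0 0))).
{ apply (vanishes_ext (fun x y => (exp ((J 0%nat 0%nat x y - H x y) * - 1) - 1) * exp (- H 0 0))).
  - intros x y h; rewrite (Hc x y h), Rmult_minus_distr_r, <- exp_plus, Rmult_1_l.
    unfold f; f_equal; f_equal; ring.
  - apply vanishes_mult; [|apply bounded_const].
    apply (vanishes_exp (fun x y => (J 0%nat 0%nat x y - H x y) * - 1)).
    apply vanishes_mult; [trivial | apply bounded_const]. }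
assert (lim : forall x y, x ^ 2 + y ^ 2 = 1 -> a + b * x + c * y + k / 2 = exp (- H 0 0)).
{ intros x y h.
  assert (e := limit_at_rim _ (fun t => a + b * (t * x) + c * (t * y) + k / 2 * (t * t) - exp (- H 0 0))
    x y vf h).
  cbv beta in e; rewrite !Rmult_1_l, Rmult_1_r in e.
  apply Rminus_diag_uniq, e.
  - intros t ht.
    assert (n : (t * x) ^ 2 + (t * y) ^ 2 = t * t).
    { replace (t * t) with (t * t * (x ^ 2 + y ^ 2)) by (rewrite h; ring); ring. }
    rewrite cf by (rewrite n; nra).
    replace (t * x * (t * x) + t * y * (t * y)) with (t * t) by (rewrite <- n; ring); reflexivity.
  - reg. }
(* The boundary value is the same at opposite points of the circle, which removes the linear
   terms. *)
assert (b0 : b = 0) by (generalize (lim 1 0 ltac:(lra)), (lim (-1) 0 ltac:(lra)); lra).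
assert (c0 : c = 0) by (generalize (lim 0 1 ltac:(lra)), (lim 0 (-1) ltac:(lra)); lra).
rewrite b0 in *; rewrite c0 in *.
assert (a0 : 0 < a) by apply exp_pos.
(* At the origin the gradient now vanishes, so [P] equals e^u / 2 there while [f] equals e^(-u). *)
assert (ka : 2 * k * a = 1).
{ assert (p0 : J 1%nat 0%nat 0 0 = 0).
  { assert (z : fx 0 0 = 0) by exact b0; unfold fx in z; assert (p := exp_pos (- J 0%nat 0%nat 0 0)); nra. }
  assert (q0 : J 0%nat 1%nat 0 0 = 0).
  { assert (z : fy 0 0 = 0) by exact c0; unfold fy in z; assert (p := exp_pos (- J 0%nat 0%nat 0 0)); nra. }
  unfold k, P, a, f; rewrite p0, q0.
  replace (2 * _ * _) with (exp (J 0%nat 0%nat 0 0) * exp (- J 0%nat 0%nat 0 0)) by field.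
  rewrite <- exp_plus, <- exp_0; f_equal; ring. }
(* With a = 1 / (2 k) the polynomial is (1 + k^2 r^2) / (2 k), the reciprocal of the claimed e^u for
   R = k. *)
exists k; split; [exact k0|split].
(* The boundary expression times [f], where r u_r f = - k r^2 and e^u f = 1. Its value at r = 1,
   multiplied by 2 k, is the quadratic in k. *)
- assert (w : vanishes_at_rim (fun x y => - k * (x * x + y * y) + lambda * f x y - 1)).
  { apply (vanishes_ext (fun x y => (x * J 1%nat 0%nat x y + y * J 0%nat 1%nat x y + lambda
      - exp (J 0%nat 0%nat x y)) * exp (- J 0%nat 0%nat x y))).
    - intros x y h; specialize (cx x y h); specialize (cy x y h).
      assert (e1 : J 1%nat 0%nat x y * exp (- J 0%nat 0%nat x y) = - (k * x)) by (unfold fx in cx; lra).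
      assert (e2 : J 0%nat 1%nat x y * exp (- J 0%nat 0%nat x y) = - (k * y)) by (unfold fy in cy; lra).
      assert (e3 : exp (J 0%nat 0%nat x y) * exp (- J 0%nat 0%nat x y) = 1).
      { rewrite <- exp_plus, <- exp_0; f_equal; ring. }
      unfold f; ring [e1 e2 e3].
    - apply vanishes_mult; [exact v | bounded]. }
  assert (e := limit_at_rim _ (fun t => - k * (t * t) + lambda * (a + k / 2 * (t * t)) - 1) 1 0 w
    ltac:(lra)).
  cbv beta in e.
  assert (e' : - k * (1 * 1) + lambda * (a + k / 2 * (1 * 1)) - 1 = 0).
  { apply e; [|reg]; intros t ht; rewrite cf by nra; field. }
  assert (ea : a = / (2 * k)) by (field_simplify_eq; [lra | lra]).
  rewrite ea in e'; apply Rmult_eq_reg_r with (/ (2 * k)); [|apply Rinv_neq_0_compat; lra].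
  rewrite Rmult_0_l, <- e'; field; lra.
- intros x y h.
  assert (ef : f x y = / (2 * k / (1 + k ^ 2 * (x ^ 2 + y ^ 2)))).
  { rewrite cf by exact h; replace a with (/ (2 * k)) by (field_simplify_eq; [lra | lra]).
    field; split; nra. }
  assert (hp : 0 < 2 * k / (1 + k ^ 2 * (x ^ 2 + y ^ 2))) by (apply Rdiv_lt_0_compat; nra).
  apply Ropp_eq_reg; rewrite <- ln_Rinv, <- ef by exact hp.
  unfold f; now rewrite ln_exp.
Qed.

(** * Regularity up to the boundary *)

Lemma Cmod_sqr (z : C) : Cmod z ^ 2 = fst z ^ 2 + snd z ^ 2.
Proof. unfold Cmod; apply pow2_sqrt; nra. Qed.

Lemma unit_disk_sqr (z : C) : unit_disk z <-> fst z ^ 2 + snd z ^ 2 < 1.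
Proof. unfold unit_disk; rewrite <- Cmod_sqr; generalize (Cmod_ge_0 z); split; nra. Qed.

Lemma closed_unit_disk_sqr (z : C) : closed_unit_disk z <-> fst z ^ 2 + snd z ^ 2 <= 1.
Proof. unfold closed_unit_disk; rewrite <- Cmod_sqr; generalize (Cmod_ge_0 z); split; nra. Qed.

Lemma unit_circle_sqr (z : C) : unit_circle z <-> fst z ^ 2 + snd z ^ 2 = 1.
Proof. unfold unit_circle; rewrite <- Cmod_sqr; generalize (Cmod_ge_0 z); split; nra. Qed.

(* Clamping the radius makes a function on the closed disk continuous on the whole plane of
   polar coordinates. *)
Definition clamped_polar (g : R -> R -> R) (r t : R) : R :=
  g (Rmax 0 (Rmin r 1) * cos t) (Rmax 0 (Rmin r 1) * sin t).

Lemma clamped_polar_id g r t : 0 <= r <= 1 -> clamped_polar g r t = g (r * cos t) (r * sin t).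
Proof. intros h; unfold clamped_polar; now rewrite clamp_id. Qed.

Lemma continuous_on_clamped_polar (g : C -> R) :
  continuous_on closed_unit_disk g ->
  forall r t, continuity_2d_pt (clamped_polar (fun x y => g (x, y))) r t.
Proof.
intros c r t eps.
set (x := fun r t => Rmax 0 (Rmin r 1) * cos t); set (y := fun r t => Rmax 0 (Rmin r 1) * sin t).
assert (cl : forall r t, closed_unit_disk (x r t, y r t)).
{ intros; apply closed_unit_disk_sqr; simpl fst; simpl snd; unfold x, y; rewrite polar_norm.
  destruct (clamp_bounds 0 1 r0 Rle_0_1); nra. }
destruct (proj1 (filterlim_locally _ _) (c _ (cl r t)) eps) as [d hd].
assert (cc : continuity_2d_pt (fun r _ => Rmax 0 (Rmin r 1)) r t).
{ apply (continuity_1d_2d_pt_comp (fun r => Rmax 0 (Rmin r 1)));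
    [apply continuity_clamp | apply continuity_2d_pt_id1]. }
destruct (continuity_2d_pt_mult _ _ _ _ cc (continuity_2d_pt_cos r t) d) as [d1 h1].
destruct (continuity_2d_pt_mult _ _ _ _ cc (continuity_2d_pt_sin r t) d) as [d2 h2].
exists (mkposreal _ (Rmin_stable_in_posreal d1 d2)); simpl; intros u v hu hv.
apply hd; [|apply cl]; split; simpl.
- apply h1; eapply Rlt_le_trans; [exact hu | apply Rmin_l | exact hv | apply Rmin_l].
- apply h2; eapply Rlt_le_trans; [exact hu | apply Rmin_r | exact hv | apply Rmin_r].
Qed.

(** The minimum and the maximum are taken on the rectangle [[0, 1] x [-PI, PI]], which polar
    coordinates map onto the closed disk. *)
Lemma clamped_polar_bounded g :
  (forall r t, continuity_2d_pt (clamped_polar g) r t) -> bounded_on_disk g.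
Proof.
intros c; assert (hpi := PI_RGT_0).
destruct (min_on_rectangle (clamped_polar g) 0 1 (- PI) PI) as (r1 & t1 & _ & _ & h1);
  [lra | lra | exact c |].
destruct (min_on_rectangle (fun r t => - clamped_polar g r t) 0 1 (- PI) PI)
  as (r2 & t2 & _ & _ & h2); [lra | lra | intros; now apply continuity_2d_pt_opp |].
exists (Rabs (clamped_polar g r1 t1) + Rabs (clamped_polar g r2 t2)); intros x y h.
destruct (polar x y) as (r & t & hr & ht & ex & ey).
assert (n := polar_norm r t); rewrite <- ex, <- ey in n.
assert (hr1 : 0 <= r <= 1) by nra.
specialize (h1 r t hr1 ht); specialize (h2 r t hr1 ht).
rewrite (clamped_polar_id g r t hr1), <- ex, <- ey in h1, h2.
generalize (Rle_abs (clamped_polar g r2 t2)), (Rabs_pos (clamped_polar g r2 t2)),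
  (Rle_abs (- clamped_polar g r1 t1)), (Rabs_pos (clamped_polar g r1 t1)).
rewrite Rabs_Ropp; intros; apply Rabs_le; lra.
Qed.

(** Uniform continuity on the same rectangle compares [(r, t)] with the boundary point [(1, t)] at
    the same angle. *)
Lemma clamped_polar_vanishes g :
  (forall r t, continuity_2d_pt (clamped_polar g) r t) ->
  (forall t, g (cos t) (sin t) = 0) -> vanishes_at_rim g.
Proof.
intros c z eps he; assert (hpi := PI_RGT_0).
destruct (uniform_continuity_2d (clamped_polar g) 0 1 (- PI) PI (fun r t _ _ => c r t)
  (mkposreal _ he)) as [d hd].
set (s := Rmax 0 (1 - d)).
assert (hs : 0 <= s < 1).
{ split; [apply Rmax_l | apply Rmax_lub_lt; generalize (cond_pos d); lra]. }
assert (q := Rmax_r 0 (1 - d)); fold s in q.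
exists (s ^ 2); split; [nra|]; intros x y h.
destruct (polar x y) as (r & t & hr & ht & ex & ey).
assert (n := polar_norm r t); rewrite <- ex, <- ey in n.
assert (hr1 : s < r < 1) by nra.
specialize (hd 1 t r t ltac:(lra) ht ltac:(lra) ht ltac:(apply Rabs_def1; lra)
  ltac:(rewrite Rminus_diag, Rabs_R0; apply cond_pos)).
rewrite !clamped_polar_id, !Rmult_1_l, z, Rminus_0_r, <- ex, <- ey in hd by lra.
exact hd.
Qed.

Definition jet_of (u : C -> R) (m k : nat) : R -> R -> R :=
  partial_derive m k (fun x y => u (x, y)).

Lemma jet_of_smooth u : smooth_closed_disk u -> jet (jet_of u).
Proof.
intros [hs _] m k.
assert (dn : forall n x y, x ^ 2 + y ^ 2 < 1 -> ex_diff_n (fun x y => u (x, y)) n x y).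
{ intros n x y h; apply (hs n (x, y)); now apply unit_disk_sqr. }
assert (ld : forall n x y, x ^ 2 + y ^ 2 < 1 -> locally_2d (ex_diff_n (fun x y => u (x, y)) n) x y).
{ intros n x y h; destruct (disk_open x y h) as [d hd]; exists d; auto. }
assert (cont : forall p q x y, x ^ 2 + y ^ 2 < 1 -> continuity_2d_pt (jet_of u p q) x y).
{ intros p q x y h.
  assert (e := ex_diff_n_deriv (p + q) p q (le_n _) _ x y (dn (p + q)%nat x y h)).
  destruct (p + q - (p + q))%nat; apply e. }
apply grad_intro; auto.
- intros x y h; apply (Derive_correct (fun t => jet_of u m k t y)).
  apply (ex_diff_n_ex_deriv_inf_1 (S (m + k)) m k (le_n _)); auto.
(* [partial_derive] differentiates in [y] before [x], so a further derivative in [y] is a genuine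
   exchange of the order of differentiation. *)
- intros x y h; unfold jet_of at 2; rewrite <- Derive_partial_derive by auto.
  apply (Derive_correct (fun t => jet_of u m k x t)).
  apply (ex_diff_n_ex_deriv_inf_2 (S (m + k)) m k (le_n _)); auto.
Qed.

(** Along the radius the mean value theorem turns the one-sided difference quotient at the rim into
    a value of the continuous [dU] at an intermediate radius, and limits are unique. *)
Lemma normal_derivative u g1 g2 t l :
  smooth_closed_disk u ->
  continuous_on closed_unit_disk g1 -> continuous_on closed_unit_disk g2 ->
  (forall z, unit_disk z -> g1 z = partial 1 0 u z) ->
  (forall z, unit_disk z -> g2 z = partial 0 1 u z) ->
  is_normal_derive u (cos t, sin t) l ->
  l = cos t * g1 (cos t, sin t) + sin t * g2 (cos t, sin t).
Proof.
intros hs c1 c2 e1 e2 hl.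
assert (hj := jet_of_smooth u hs).
destruct hs as (_ & cu & _).
set (U := fun r => clamped_polar (fun x y => u (x, y)) r t).
set (dU := fun r => cos t * clamped_polar (fun x y => g1 (x, y)) r t
  + sin t * clamped_polar (fun x y => g2 (x, y)) r t).
assert (cU : forall r, continuity_pt U r).
{ intros r; apply continuity_pt_filterlim.
  now apply (continuous_2d_fst (clamped_polar (fun x y => u (x, y)))), continuous_on_clamped_polar. }
assert (cdU : continuity_pt dU 1).
{ apply continuity_pt_filterlim, (continuous_2d_fst (fun r t =>
    cos t * clamped_polar (fun x y => g1 (x, y)) r t
    + sin t * clamped_polar (fun x y => g2 (x, y)) r t)).
  apply continuity_2d_pt_plus; apply continuity_2d_pt_mult;
    try apply continuity_2d_pt_cos; try apply continuity_2d_pt_sin;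
    now apply continuous_on_clamped_polar. }
assert (dd : forall r, 0 < r < 1 -> is_derive U r (dU r)).
{ intros r hr.
  assert (hd : (r * cos t) ^ 2 + (r * sin t) ^ 2 < 1) by (rewrite polar_norm; nra).
  apply (is_derive_ext_loc (fun r => jet_of u 0 0 (r * cos t) (r * sin t))).
  - assert (n : locally r (fun s => 0 < s < 1)).
    { apply filter_and; [now apply open_gt | now apply open_lt]. }
    refine (filter_imp _ _ _ n); intros s h; unfold U; now rewrite clamped_polar_id by lra.
  - evar_last; [apply (grad_comp _ _ _ (fun r => r * cos t) (fun r => r * sin t) r
      (cos t) (sin t) (hj 0%nat 0%nat) hd); auto_derive; trivial; ring|].
    unfold dU; rewrite !clamped_polar_id by lra.
    rewrite e1, e2 by now apply unit_disk_sqr.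
    unfold partial, jet_of; simpl Re; simpl Im; ring. }
assert (lim : is_normal_derive u (cos t, sin t) (dU 1)).
{ apply filterlim_locally; intros eps.
  destruct (proj1 (continuity_pt_locally dU 1) cdU eps) as [d hd].
  assert (hd0 : 0 < Rmin d 1) by (apply Rmin_pos; [apply cond_pos | lra]).
  exists (mkposreal _ hd0); intros s hs0 hs.
  change (Rabs (s - 0) < Rmin d 1) in hs0; apply Rabs_def2 in hs0.
  assert (q1 := Rmin_l d 1); assert (q2 := Rmin_r d 1).
  destruct (MVT_gen U (1 + s) 1 dU) as [a [ha ea]].
  - rewrite Rmin_left, Rmax_right by lra; intros; apply dd; lra.
  - intros; apply cU.
  - rewrite Rmin_left, Rmax_right in ha by lra.
    replace ((u _ - u _) / s) with (dU a).
    + apply (hd a); apply Rabs_def1; unfold minus, plus, opp; simpl; lra.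
    + unfold U in ea; rewrite !clamped_polar_id in ea by lra.
      rewrite !Rmult_1_l in ea.
      replace (Cplus (cos t, sin t) (Cmult (RtoC s) (cos t, sin t)))
        with ((1 + s) * cos t, (1 + s) * sin t).
      * replace (dU a) with (- (dU a * (1 - (1 + s))) / s) by (field; lra).
        rewrite <- ea; field; lra.
      * unfold Cplus, Cmult, RtoC; simpl; f_equal; ring. }
rewrite (filterlim_locally_unique (F := at_left 0) _ _ _ hl lim).
unfold dU; rewrite !clamped_polar_id, !Rmult_1_l by lra; reflexivity.
Qed.

Lemma interior_solution_of lambda u :
  smooth_closed_disk u -> solves_P lambda u -> interior_solution lambda (jet_of u).
Proof.
intros hs [pde bc].
split; [now apply jet_of_smooth|].
assert (hs' := hs); destruct hs' as (_ & cu & ext).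
split; [|split].
- intros m k; destruct (ext m k) as (g & cg & eg).
  destruct (clamped_polar_bounded _ (continuous_on_clamped_polar g cg)) as [M hM].
  exists M; intros x y h; specialize (hM x y h).
  rewrite eg in hM; [exact hM | now apply unit_disk_sqr].
- intros x y h; specialize (pde (x, y) (proj2 (unit_disk_sqr (x, y)) h)).
  unfold laplacian, partial in pde; simpl Re in pde; simpl Im in pde.
  change (jet_of u 0 0 x y) with (u (x, y)); rewrite <- pde; unfold jet_of; ring.
- destruct (ext 1%nat 0%nat) as (g1 & c1 & e1); destruct (ext 0%nat 1%nat) as (g2 & c2 & e2).
  (* On the circle [jet_of u] would depend on the values of [u] outside the closed disk, so the
     continuous extensions [g1] and [g2] take its place. *)
  apply (vanishes_ext (fun x y => x * g1 (x, y) + y * g2 (x, y) + lambda - exp (u (x, y)))).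
  + intros x y h; rewrite e1, e2 by now apply unit_disk_sqr.
    reflexivity.
  + apply clamped_polar_vanishes.
    * intros r t.
      change (continuity_2d_pt (fun r t =>
        Rmax 0 (Rmin r 1) * cos t * clamped_polar (fun x y => g1 (x, y)) r t
        + Rmax 0 (Rmin r 1) * sin t * clamped_polar (fun x y => g2 (x, y)) r t
        + lambda - exp (clamped_polar (fun x y => u (x, y)) r t)) r t).
      apply continuity_2d_pt_minus.
      -- apply continuity_2d_pt_plus; [|apply continuity_2d_pt_const].
         apply continuity_2d_pt_plus; repeat apply continuity_2d_pt_mult;
           try apply continuity_2d_pt_cos; try apply continuity_2d_pt_sin;
           try (now apply continuous_on_clamped_polar);
           apply (continuity_1d_2d_pt_comp (fun r => Rmax 0 (Rmin r 1)));
           try apply continuity_clamp; apply continuity_2d_pt_id1.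
      -- apply (continuity_1d_2d_pt_comp exp); [apply derivable_continuous, derivable_exp|].
         now apply continuous_on_clamped_polar.
    * intros t; destruct (bc (cos t, sin t)) as (l & hl & el).
      { apply unit_circle_sqr; apply cos2_sin2. }
      rewrite <- el, (normal_derivative u g1 g2 t l hs c1 c2 e1 e2 hl); ring.
Qed.

(** The circle is reached by continuity: along a radius the difference between [u] and the formula
    is 0 before the rim and continuous at it, so [limit_at_rim] applies with the zero function. *)
Lemma solution_radial lambda u :
  lambda <= 2 -> lambda <> 1 -> smooth_closed_disk u -> solves_P lambda u ->
  exists r, 0 < r /\ (lambda - 2) * r ^ 2 - 2 * r + lambda = 0 /\
    forall z, closed_unit_disk z -> u z = ln (2 * r / (1 + r ^ 2 * Cmod z ^ 2)).
Proof.
intros hl2 hl hs hP.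
destruct (interior_solution_radial lambda (jet_of u) hl2 hl (interior_solution_of lambda u hs hP))
  as (r & hr & er & hu).
exists r; split; [exact hr | split; [exact er|]]; intros [x y] hz.
apply closed_unit_disk_sqr in hz; rewrite Cmod_sqr; simpl fst in *; simpl snd in *.
destruct (Rle_lt_or_eq_dec _ _ hz) as [h|h]; [exact (hu x y h)|].
destruct (polar x y) as (p & t & hp & _ & ex & ey).
assert (n := polar_norm p t); rewrite <- ex, <- ey in n.
assert (p1 : p = 1) by nra; subst p; rewrite Rmult_1_l in ex, ey.
apply Rminus_diag_uniq.
assert (e := limit_at_rim (fun _ _ => 0)
  (fun s => clamped_polar (fun x y => u (x, y)) s t - ln (2 * r / (1 + r ^ 2 * s ^ 2))) x y).
cbv beta in e; rewrite clamped_polar_id, !Rmult_1_l, <- ex, <- ey, pow1 in e by lra.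
rewrite h; apply e; trivial.
- intros eps he; exists 0; split; [lra|]; intros; rewrite Rabs_R0; exact he.
- intros s h1; rewrite clamped_polar_id by lra; rewrite <- ex, <- ey.
  assert (k : (s * x) ^ 2 + (s * y) ^ 2 = s ^ 2).
  { replace (s ^ 2) with (s ^ 2 * (x ^ 2 + y ^ 2)) by (rewrite h; ring); ring. }
  specialize (hu (s * x) (s * y) ltac:(rewrite k; nra)); rewrite k in hu.
  change (u (s * x, s * y) = ln (2 * r / (1 + r ^ 2 * s ^ 2))) in hu; rewrite hu; ring.
- apply continuity_pt_minus.
  + apply continuity_pt_filterlim, (continuous_2d_fst (clamped_polar (fun x y => u (x, y)))).
    apply continuous_on_clamped_polar, hs.
  + apply continuity_pt_filterlim, (ex_derive_continuous (fun s => ln (2 * r / (1 + r ^ 2 * s ^ 2)))).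
    auto_derive; split; [nra|split; trivial]; apply Rdiv_lt_0_compat; nra.
Qed.

Theorem theorem1p1 (lambda : R) (hle : lambda <= 2) (hne : lambda <> 1) :
  (lambda <= 0 ->
     ~ exists u : C -> R, smooth_closed_disk u /\ solves_P lambda u) /\
  (0 < lambda ->
     exists r : R,
       unique (fun s : R =>
         0 < s /\ (lambda - 2) * s ^ 2 - 2 * s + lambda = 0) r /\
       (forall u : C -> R, smooth_closed_disk u -> solves_P lambda u ->
          forall z : C, closed_unit_disk z ->
            u z = ln (2 * r / (1 + r ^ 2 * Cmod z ^ 2)))).
Proof.
split.
- intros h0 [u [hs hP]].
  (* For [lambda <= 0] and [r > 0] no term of the quadratic is positive, and [- 2 * r] is
     negative. *)
  destruct (solution_radial lambda u hle hne hs hP) as (r & hr & er & _); nra.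
- intros h0.
  assert (uniq : forall s s', 0 < s -> 0 < s' -> (lambda - 2) * s ^ 2 - 2 * s + lambda = 0 ->
    (lambda - 2) * s' ^ 2 - 2 * s' + lambda = 0 -> s = s').
  { intros s s' hs hs' e e'.
    (* The difference of the two equations; its second factor is at least 2. *)
    assert (f : (s - s') * ((2 - lambda) * (s + s') + 2) = 0) by nra.
    apply Rmult_integral in f; destruct f as [f|f]; nra. }
  (* [q ^ 2] is a quarter of the discriminant. The positive root is written in the rationalised form
     [lambda / (1 + q)], which remains valid at [lambda = 2], where the equation becomes linear. *)
  set (q := sqrt (1 + lambda * (2 - lambda))).
  assert (hq : q * q = 1 + lambda * (2 - lambda)) by (apply sqrt_sqrt; nra).
  assert (hq0 : 0 <= q) by apply sqrt_pos.
  assert (hr : 0 < lambda / (1 + q) /\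
    (lambda - 2) * (lambda / (1 + q)) ^ 2 - 2 * (lambda / (1 + q)) + lambda = 0).
  { split; [apply Rdiv_lt_0_compat; lra|].
    replace (_ - _ + _) with (lambda * (q * q - (1 + lambda * (2 - lambda))) / (1 + q) ^ 2)
      by (field; lra).
    rewrite hq, Rminus_diag, Rmult_0_r; apply Rmult_0_l. }
  exists (lambda / (1 + q)); split.
  + split; [exact hr|]; intros s [hs es]; apply uniq; tauto.
  + intros u hs hP.
    destruct (solution_radial lambda u hle hne hs hP) as (r & hr' & er & hu).
    rewrite <- (uniq r _ hr' (proj1 hr) er (proj2 hr)); exact hu.
Qed.
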